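(* Let $m\ge 5$ and let $\mathcal{G}=\{G_v : v\in V(C_m)\}$ be any collection of nontrivial groups. Then the graph product $GP(C_m,\mathcal{G})$ contains a hyperbolic surface group.
   Context: $C_m$ denotes the cycle graph of length $m$. For a graph $\Gamma$ and groups $\mathcal{G}=\{G_v: v\in V(\Gamma)\}$, the graph product $GP(\Gamma,\mathcal{G})$ is the quotient of the free product of the groups $G_v$ by the normal closure of $\{[g,h] : g\in G_u, h\in G_v, \{u,v\}\in E(\Gamma)\}$. A hyperbolic surface group is the fundamental group of a closed hyperbolic surface; ''contains'' means as an isomorphic copy of a subgroup. *)

(* Defs.v *)
From HB Require Import structures.
From mathcomp Require Import all_boot all_order all_algebra.
From mathcomp Require Import all_classical all_reals all_analysis.
From mathcomp Require Import homotopy lra.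

Set Implicit Arguments.
Unset Strict Implicit.
Unset Printing Implicit Defensive.

Import Order.TTheory GRing.Theory Num.Theory.
Import numFieldNormedType.Exports.

Local Open Scope quotient_scope.
Local Open Scope classical_set_scope.
Local Open Scope ring_scope.

(* A set of representatives, such as words or loops, on which the group laws
   hold up to the equivalence relation pg_eq; pg_group is the group of classes. *)
Record pregroup := Pregroup {
  pg_sort :> choiceType;
  pg_eq : pg_sort -> pg_sort -> Prop;
  pg_mul : pg_sort -> pg_sort -> pg_sort;
  pg_one : pg_sort;
  pg_inv : pg_sort -> pg_sort;
  pg_refl : forall x, pg_eq x x;
  pg_sym : forall x y, pg_eq x y -> pg_eq y x;
  pg_trans : forall y x z, pg_eq x y -> pg_eq y z -> pg_eq x z;
  pg_mul_congr : forall x x' y y',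
    pg_eq x x' -> pg_eq y y' -> pg_eq (pg_mul x y) (pg_mul x' y');
  pg_mulA : forall x y z,
    pg_eq (pg_mul x (pg_mul y z)) (pg_mul (pg_mul x y) z);
  pg_mul1g : forall x, pg_eq (pg_mul pg_one x) x;
  pg_mulg1 : forall x, pg_eq (pg_mul x pg_one) x;
  pg_mulVg : forall x, pg_eq (pg_mul (pg_inv x) x) pg_one;
  pg_mulgV : forall x, pg_eq (pg_mul x (pg_inv x)) pg_one }.

Section PregroupQuotient.
Context (S : pregroup).

Definition pg_rel (x y : S) : bool := `[< pg_eq x y >].

Lemma pg_rel_refl : reflexive pg_rel.
Proof. by move=> x; apply/asboolP; exact: pg_refl. Qed.

Lemma pg_rel_sym : symmetric pg_rel.
Proof. by move=> x y; apply/asboolP/asboolP; exact: pg_sym. Qed.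

Lemma pg_rel_trans : transitive pg_rel.
Proof.
by move=> y x z /asboolP xy /asboolP yz; apply/asboolP; exact: pg_trans xy yz.
Qed.

Canonical pg_equiv := EquivRel pg_rel pg_rel_refl pg_rel_sym pg_rel_trans.

Definition pg_quot : Type := {eq_quot pg_equiv}.
HB.instance Definition _ := Choice.on pg_quot.

Definition pg_class (x : S) : pg_quot := \pi_({eq_quot pg_equiv}) x.

Lemma pg_classP (x y : S) : pg_class x = pg_class y <-> pg_eq x y.
Proof. by split=> [/eqmodP/asboolP//|xy]; apply/eqmodP/asboolP. Qed.

Definition pg_repr (a : pg_quot) : S := repr (a : {eq_quot pg_equiv}).

Lemma pg_reprK (a : pg_quot) : pg_class (pg_repr a) = a.
Proof. exact: reprK. Qed.

Lemma pg_class_surj (a : pg_quot) : exists x : S, a = pg_class x.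
Proof. by exists (pg_repr a); rewrite pg_reprK. Qed.

Lemma pg_repr_class (x : S) : pg_eq (pg_repr (pg_class x)) x.
Proof. by apply/pg_classP; rewrite pg_reprK. Qed.

Definition pgq_mul (a b : pg_quot) : pg_quot :=
  pg_class (pg_mul (pg_repr a) (pg_repr b)).
Definition pgq_inv (a : pg_quot) : pg_quot := pg_class (pg_inv (pg_repr a)).
Definition pgq_one : pg_quot := pg_class (pg_one S).

Lemma pgq_mulE (x y : S) :
  pgq_mul (pg_class x) (pg_class y) = pg_class (pg_mul x y).
Proof. by apply/pg_classP; apply: pg_mul_congr; exact: pg_repr_class. Qed.

Lemma pgq_mulA : associative pgq_mul.
Proof.
move=> a b c; have [x ->] := pg_class_surj a; have [y ->] := pg_class_surj b.
have [z ->] := pg_class_surj c; rewrite !pgq_mulE; exact/pg_classP/pg_mulA.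
Qed.

Lemma pgq_mul1g : left_id pgq_one pgq_mul.
Proof.
move=> a; have [x ->] := pg_class_surj a; rewrite pgq_mulE.
exact/pg_classP/pg_mul1g.
Qed.

Lemma pgq_mulg1 : right_id pgq_one pgq_mul.
Proof.
move=> a; have [x ->] := pg_class_surj a; rewrite pgq_mulE.
exact/pg_classP/pg_mulg1.
Qed.

Lemma pgq_mulVg : left_inverse pgq_one pgq_inv pgq_mul.
Proof.
move=> a; rewrite -[X in pgq_mul _ X]pg_reprK pgq_mulE.
exact/pg_classP/pg_mulVg.
Qed.

Lemma pgq_mulgV : right_inverse pgq_one pgq_inv pgq_mul.
Proof.
move=> a; rewrite -[X in pgq_mul X _]pg_reprK pgq_mulE.
exact/pg_classP/pg_mulgV.
Qed.

HB.instance Definition _ := isGroup.Build pg_quot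
  pgq_mulA pgq_mul1g pgq_mulg1 pgq_mulVg pgq_mulgV.

Definition pg_group : groupType := pg_quot.

End PregroupQuotient.

Lemma pg_classM (S : pregroup) (x y : S) :
  (pg_class (pg_mul x y) = pg_class x * pg_class y :> pg_group S)%g.
Proof. by rewrite -pgq_mulE. Qed.

Lemma pg_class1 (S : pregroup) : (pg_class (pg_one S) = 1 :> pg_group S)%g.
Proof. by []. Qed.

(* Multiplicative maps between groups preserve 1 and inverses. *)
Definition group_iso (H G : groupType) : Prop :=
  exists2 f : H -> G, {morph f : x y / (x * y)%g} & bijective f.

Definition group_embeds (H G : groupType) : Prop :=
  exists2 f : H -> G, {morph f : x y / (x * y)%g} & injective f.

Definition normal_subgroup (F : groupType) (N : set F) : Prop :=
  [/\ N 1%g, forall x y, N x -> N y -> N (x * y)%g,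
      forall x, N x -> N (x^-1)%g & forall x y, N x -> N (x ^ y)%g].

Definition normal_closure (F : groupType) (A : set F) : set F :=
  smallest (@normal_subgroup F) A.

Section NormalQuotient.
Context (F : groupType) (A : set F).
Local Notation N := (normal_closure A).

Lemma normal_closure_normal : normal_subgroup N.
Proof.
split=> [M [[]]//|x y Nx Ny M MA|x Nx M MA|x y Nx M MA].
- by have [[_ + _ _] _] := MA; apply; [exact: Nx|exact: Ny].
- by have [[_ _ + _] _] := MA; apply; exact: Nx.
- by have [[_ _ _ +] _] := MA; apply; exact: Nx.
Qed.

Definition coset_eq (x y : F) : Prop := N (x^-1 * y)%g.

Let N1 : N 1%g. Proof. by have [] := normal_closure_normal. Qed.

Let NM x y : N x -> N y -> N (x * y)%g.
Proof. by have [_ + _ _] := normal_closure_normal; apply. Qed.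

Let NV x : N x -> N (x^-1)%g.
Proof. by have [_ _ + _] := normal_closure_normal; apply. Qed.

Let NJ x y : N x -> N (x ^ y)%g.
Proof. by have [_ _ _] := normal_closure_normal; apply. Qed.

Lemma coset_eq_refl x : coset_eq x x.
Proof. by rewrite /coset_eq mulVg. Qed.

Lemma coset_eq_sym x y : coset_eq x y -> coset_eq y x.
Proof. by move=> /NV; rewrite invgM invgK. Qed.

Lemma coset_eq_trans y x z : coset_eq x y -> coset_eq y z -> coset_eq x z.
Proof. by move=> xy yz; have := NM xy yz; rewrite -mulgA mulVKg. Qed.

Lemma coset_eq_mul x x' y y' :
  coset_eq x x' -> coset_eq y y' -> coset_eq (x * y)%g (x' * y')%g.
Proof.
move=> xx' yy'; have := NM (NJ y xx') yy'.
by rewrite /coset_eq conjgE invgM !mulgA mulgK.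
Qed.

Lemma coset_eq_eq x y : x = y -> coset_eq x y.
Proof. by move->; exact: coset_eq_refl. Qed.

Definition normal_quotient_pregroup : pregroup :=
  @Pregroup F coset_eq (fun x y => x * y)%g 1%g (fun x => x^-1)%g
    coset_eq_refl coset_eq_sym coset_eq_trans
    coset_eq_mul
    (fun x y z => coset_eq_eq (mulgA x y z))
    (fun x => coset_eq_eq (mul1g x)) (fun x => coset_eq_eq (mulg1 x))
    (fun x => coset_eq_eq (mulVg x)) (fun x => coset_eq_eq (mulgV x)).

Definition normal_quotient : groupType := pg_group normal_quotient_pregroup.

End NormalQuotient.

Section FreeProduct.
Context (V : choiceType) (G : V -> groupType).

Definition syllable : choiceType := {v : V & G v}.
Definition syl (v : V) (g : G v) : syllable := existT (fun v => G v : Type) v g.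
Definition word : choiceType := seq syllable.

(* The free product is realized as words in the disjoint union of the G v, not
   necessarily reduced, modulo the relations holding in each G v. *)
Inductive free_eq : word -> word -> Prop :=
| free_refl (w : word) : free_eq w w
| free_sym (w1 w2 : word) : free_eq w1 w2 -> free_eq w2 w1
| free_trans (w2 w1 w3 : word) : free_eq w1 w2 -> free_eq w2 w3 -> free_eq w1 w3
| free_unit (w1 w2 : word) (v : V) :
    free_eq (w1 ++ syl (1%g : G v) :: w2) (w1 ++ w2)
| free_syllable (w1 w2 : word) (v : V) (g h : G v) :
    free_eq (w1 ++ [:: syl g, syl h & w2])
            (w1 ++ syl (g * h)%g :: w2).

Definition word_inv (w : word) : word :=
  rev [seq syl ((tagged s)^-1)%g | s : syllable <- w].

Lemma free_catl (w w1 w2 : word) : free_eq w1 w2 -> free_eq (w ++ w1) (w ++ w2).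
Proof.
elim=> {w1 w2} [w1|w1 w2 _|w2 w1 w3 _ + _|w1 w2 v|w1 w2 v g h].
- exact: free_refl.
- exact: free_sym.
- exact: free_trans.
- rewrite !catA; exact: free_unit.
- rewrite !catA; exact: free_syllable.
Qed.

Lemma free_catr (w w1 w2 : word) : free_eq w1 w2 -> free_eq (w1 ++ w) (w2 ++ w).
Proof.
elim=> {w1 w2} [w1|w1 w2 _|w2 w1 w3 _ + _|w1 w2 v|w1 w2 v g h].
- exact: free_refl.
- exact: free_sym.
- exact: free_trans.
- rewrite -!catA; exact: free_unit.
- rewrite -!catA; exact: free_syllable.
Qed.

Lemma free_cat (w1 w1' w2 w2' : word) :
  free_eq w1 w1' -> free_eq w2 w2' -> free_eq (w1 ++ w2) (w1' ++ w2').
Proof. by move=> /(free_catr w2) + /(free_catl w1'); exact: free_trans. Qed.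

Lemma free_eq_eq (w1 w2 : word) : w1 = w2 -> free_eq w1 w2.
Proof. by move->; exact: free_refl. Qed.

Lemma free_mulV w : free_eq (word_inv w ++ w) [::].
Proof.
elim: w => [|[v g] w IH]; first exact: free_refl.
rewrite /word_inv /= rev_cons cat_rcons.
apply: free_trans (free_syllable _ _ _ _) _; rewrite mulVg.
exact: free_trans (free_unit _ _ _) IH.
Qed.

Lemma word_invK : involutive word_inv.
Proof.
move=> w; rewrite /word_inv map_rev revK -map_comp -[RHS]map_id.
by apply: eq_map => -[v g] /=; rewrite invgK.
Qed.

Lemma free_Vmul w : free_eq (w ++ word_inv w) [::].
Proof. by have := free_mulV (word_inv w); rewrite word_invK. Qed.

Definition free_product_pregroup : pregroup :=
  @Pregroup word free_eq (fun w1 w2 => w1 ++ w2) [::] word_inv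
    free_refl free_sym free_trans free_cat
    (fun x y z => free_eq_eq (catA x y z)) free_refl
    (fun x => free_eq_eq (cats0 x)) free_mulV free_Vmul.

Definition free_product : groupType := pg_group free_product_pregroup.

Definition free_in (v : V) (g : G v) : free_product :=
  @pg_class free_product_pregroup [:: syl g].

End FreeProduct.

Definition edge_commutators (V : choiceType) (E : rel V) (G : V -> groupType) :
    set (free_product G) :=
  [set x | exists u v (g : G u) (h : G v),
     E u v /\ x = [~ free_in g, free_in h]%g].

Arguments edge_commutators {V} E G.

Definition graph_product (V : choiceType) (E : rel V) (G : V -> groupType) :
    groupType :=
  normal_quotient (edge_commutators E G).

(* ordS is the successor modulo m, so this is the cycle of length m as soon as
   m >= 3. *)
Definition cycle_graph (m : nat) : rel 'I_m :=
  fun i j => (j == ordS i) || (i == ordS j).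

Section UnitInterval.
Context (R : realType).

Definition unit_interval : Type := set_type `[0 : R, 1].
HB.instance Definition _ := Topological.on unit_interval.

Definition clampI (r : R) : unit_interval.
Proof.
exists (Num.max 0 (Num.min r 1)); apply/mem_set => /=.
by rewrite in_itv /= le_max lexx /= ge_max ler01 ge_min lexx orbT.
Defined.

Definition valI (t : unit_interval) : R := set_val t.

Lemma valI_itv t : 0 <= valI t <= 1.
Proof. by have /set_mem := valP t; rewrite /= in_itv. Qed.

Lemma valI_inj : injective valI.
Proof. exact: val_inj. Qed.

Lemma clampIE r : 0 <= r <= 1 -> valI (clampI r) = r.
Proof.
by move=> /andP[r0 r1]; rewrite /valI set_valE /= (min_idPl r1) (max_idPr r0).
Qed.

Lemma valIK t : clampI (valI t) = t.
Proof. by apply: valI_inj; rewrite clampIE// valI_itv. Qed.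

Lemma clampI_neq : clampI 0 != clampI 1.
Proof.
apply/eqP => /(congr1 valI); rewrite !clampIE ?lexx ?ler01//.
by move/eqP; rewrite eq_sym oner_eq0.
Qed.

HB.instance Definition _ :=
  isBiPointed.Build unit_interval clampI_neq.

End UnitInterval.

Section Paste.
Context (R : realType).
Local Notation I := (unit_interval R).

Lemma valI_cts : continuous (@valI R).
Proof. exact: initial_continuous. Qed.

Lemma clampI_cts : continuous (@clampI R).
Proof.
apply: continuous_comp_initial => r.
apply: (@continuous_max _ _ (cst 0) (fun r : R => Num.min r 1)).
  exact: cvg_cst.
by apply: (@continuous_min _ _ id (cst 1)); [exact: cvg_id|exact: cvg_cst].
Qed.

Lemma valI0 : valI (zero : I) = 0.
Proof. by rewrite clampIE// lexx ler01. Qed.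

Lemma valI1 : valI (one : I) = 1.
Proof. by rewrite clampIE// lexx ler01. Qed.

Lemma clampI_le0 (r : R) : r <= 0 -> clampI r = zero.
Proof.
move=> r0; apply: valI_inj; rewrite valI0 /valI set_valE /=.
by rewrite (max_idPl _)// ge_min r0.
Qed.

Lemma clampI_ge1 (r : R) : 1 <= r -> clampI r = one.
Proof.
move=> r1; apply: valI_inj; rewrite valI1 /valI set_valE /=.
by rewrite (min_idPr r1) (max_idPr ler01).
Qed.

Lemma paste_cts (T Y : topologicalType) (c : T -> R) (a : R) (F G : T -> Y) :
  continuous c -> continuous F -> continuous G ->
  (forall t, c t = a -> F t = G t) ->
  continuous (fun t => if c t <= a then F t else G t).
Proof.
move=> cc cF cG FG t U /= nU.
have FF : Filter (nbhs t) := nbhs_filter t.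
have nW (P Q S : set T) : nbhs t P -> nbhs t Q -> (forall s, P s -> Q s -> S s) -> nbhs t S.
  by move=> nP nQ PQS; apply: (@filterS2 T (nbhs t) FF P Q S).
have nF : nbhs (F t) U -> nbhs t [set s | U (F s)] by exact: cF.
have nG : nbhs (G t) U -> nbhs t [set s | U (G s)] by exact: cG.
suff : nbhs t [set s | U (if c s <= a then F s else G s)] by [].
move: nU; case: (ltgtP (c t) a) => [cta nU|cta nU|cta nU].
- have cl : nbhs t [set s | c s < a] by exact: (cvgr_lt _ (cc t)).
  apply: (nW _ _ _ cl (nF nU)) => s /= sa; by rewrite (ltW sa).
- have cg : nbhs t [set s | a < c s] by exact: (cvgr_gt _ (cc t)).
  apply: (nW _ _ _ cg (nG nU)) => s /= sa; by rewrite leNgt sa.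
- have nU' : nbhs (G t) U by rewrite -FG.
  apply: (nW _ _ _ (nF nU) (nG nU')) => s /= FU GU; by case: ifP.
Qed.

End Paste.

Section PathHomotopy.
Context (R : realType) (X : topologicalType).
Local Notation I := (unit_interval R).
Local Notation "x ~~> y" := {path I from x to y in X} (at level 70).

Definition path_homotopic (x y : X) (p q : x ~~> y) : Prop :=
  exists H : I * I -> X,
    [/\ continuous H, forall t, H (t, zero) = p t, forall t, H (t, one) = q t,
        forall s, H (zero, s) = x & forall s, H (one, s) = y].

Definition path_cat_fun (p q : I -> X) (t : I) : X :=
  if valI t <= 2^-1 then p (clampI (2 * valI t))
  else q (clampI (2 * valI t - 1)).

Lemma affine_cts (T : topologicalType) (c : T -> R) (a b : R) :
  continuous c -> continuous (fun t => a * c t + b).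
Proof.
by move=> cc t; apply: cvgD; [apply: cvgM; [exact: cvg_cst|exact: cc]|exact: cvg_cst].
Qed.

Lemma scale_cts (T : topologicalType) (c : T -> R) (a : R) :
  continuous c -> continuous (fun t => a * c t).
Proof. by move=> cc t; apply: cvgM; [exact: cvg_cst|exact: cc]. Qed.

Lemma rsub_cts (T : topologicalType) (c : T -> R) :
  continuous c -> continuous (fun t => 1 - c t).
Proof.
move=> cc; have -> : (fun t => 1 - c t) = (fun t => -1 * c t + 1).
  by apply/funext => t; rewrite mulN1r addrC.
exact: affine_cts.
Qed.

Lemma comp_clamp_cts (T Y : topologicalType) (c : T -> R) (f : I -> Y) :
  continuous c -> continuous f -> continuous (fun t => f (clampI (c t))).
Proof.
move=> cc cf t; apply: (@continuous_comp _ _ _ (fun t => clampI (c t)) f).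
  by apply: (@continuous_comp _ _ _ c (@clampI R)); [exact: cc|exact: clampI_cts].
exact: cf.
Qed.

Lemma comp2_clamp_cts (T Y : topologicalType) (c d : T -> R) (f : I * I -> Y) :
  continuous c -> continuous d -> continuous f ->
  continuous (fun t => f (clampI (c t), clampI (d t))).
Proof.
move=> cc cd cf t.
apply: (@continuous_comp _ _ _ (fun t => (clampI (c t), clampI (d t))) f).
  have cc' : continuous (fun t => clampI (c t)).
    exact: (@comp_clamp_cts _ _ c id cc (fun=> cvg_id)).
  have cd' : continuous (fun t => clampI (d t)).
    exact: (@comp_clamp_cts _ _ d id cd (fun=> cvg_id)).
  exact: (cvg_pair (cc' t) (cd' t)).
exact: cf.
Qed.


Lemma path_cat_cts (x y z : X) (p : x ~~> y) (q : y ~~> z) :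
  continuous (path_cat_fun p q).
Proof.
have cv := @scale_cts I (@valI R) 2 (@valI_cts R).
have cv' := @affine_cts I (@valI R) 2 (-1) (@valI_cts R).
apply: paste_cts; first exact: valI_cts.
- exact: comp_clamp_cts cv (@cts_fun _ _ p).
- exact: comp_clamp_cts cv' (@cts_fun _ _ q).
- move=> t ->; rewrite clampI_ge1; last lra.
  by rewrite clampI_le0 ?path_one ?path_zero//; lra.
Qed.

Lemma path_cat_zero (x y z : X) (p : x ~~> y) (q : y ~~> z) :
  path_cat_fun p q zero = x.
Proof.
rewrite /path_cat_fun valI0 ifT; last lra.
by rewrite clampI_le0 ?path_zero//; lra.
Qed.

Lemma path_cat_one (x y z : X) (p : x ~~> y) (q : y ~~> z) :
  path_cat_fun p q one = z.
Proof.
rewrite /path_cat_fun valI1 ifF; last by apply/negbTE; rewrite -ltNge; lra.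
by rewrite clampI_ge1 ?path_one//; lra.
Qed.

Definition path_cat (x y z : X) (p : x ~~> y) (q : y ~~> z) : x ~~> z :=
  mk_path (@path_cat_cts x y z p q) (path_cat_zero p q) (path_cat_one p q).

Definition path_rev_fun (p : I -> X) (t : I) : X := p (clampI (1 - valI t)).

Lemma path_rev_cts (x y : X) (p : x ~~> y) : continuous (path_rev_fun p).
Proof.
exact: comp_clamp_cts (rsub_cts (@valI_cts R)) (@cts_fun _ _ p).
Qed.

Lemma path_rev_zero (x y : X) (p : x ~~> y) : path_rev_fun p zero = y.
Proof. by rewrite /path_rev_fun valI0 clampI_ge1 ?path_one//; lra. Qed.

Lemma path_rev_one (x y : X) (p : x ~~> y) : path_rev_fun p one = x.
Proof. by rewrite /path_rev_fun valI1 clampI_le0 ?path_zero//; lra. Qed.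

Definition path_rev (x y : X) (p : x ~~> y) : y ~~> x :=
  mk_path (@path_rev_cts x y p) (path_rev_zero p) (path_rev_one p).

Lemma path_revE (x y : X) (p : x ~~> y) (t : I) :
  path_rev p t = p (clampI (1 - valI t)).
Proof. by []. Qed.

Let fstI_cts : continuous (fun ts : I * I => valI ts.1).
Proof.
move=> t; apply: (@continuous_comp _ _ _ fst (@valI R)).
  exact: cvg_fst.
exact: valI_cts.
Qed.

Let sndI_cts : continuous (fun ts : I * I => valI ts.2).
Proof.
move=> t; apply: (@continuous_comp _ _ _ snd (@valI R)).
  exact: cvg_snd.
exact: valI_cts.
Qed.

Lemma path_reparam (x y : X) (f g : x ~~> y) (p : I -> X) (phi psi : I -> R) :
  continuous p -> continuous phi -> continuous psi ->
  phi zero = psi zero -> phi one = psi one ->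
  (forall t, f t = p (clampI (phi t))) ->
  (forall t, g t = p (clampI (psi t))) -> path_homotopic f g.
Proof.
move=> cp cphi cpsi e0 e1 fE gE.
exists (fun ts => p (clampI ((1 - valI ts.2) * phi ts.1 + valI ts.2 * psi ts.1))).
split.
- apply: comp_clamp_cts => // t; apply: cvgD; apply: cvgM.
  + exact: (rsub_cts sndI_cts).
  + by apply: (@continuous_comp _ _ _ fst phi); [exact: cvg_fst|exact: cphi].
  + exact: sndI_cts.
  + by apply: (@continuous_comp _ _ _ fst psi); [exact: cvg_fst|exact: cpsi].
- by move=> t; rewrite fE /= valI0 subr0 mul1r mul0r addr0.
- by move=> t; rewrite gE /= valI1 subrr mul0r mul1r add0r.
- by move=> s /=; rewrite -e0 -mulrDl subrK mul1r -fE path_zero.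
- by move=> s /=; rewrite -e1 -mulrDl subrK mul1r -fE path_one.
Qed.

Lemma path_homotopic_refl (x y : X) (f : x ~~> y) : path_homotopic f f.
Proof.
apply: (@path_reparam _ _ f f f (@valI R) (@valI R)) => //.
- exact: cts_fun.
- exact: valI_cts.
- exact: valI_cts.
- by move=> t; rewrite valIK.
- by move=> t; rewrite valIK.
Qed.

Lemma path_homotopic_sym (x y : X) (f g : x ~~> y) :
  path_homotopic f g -> path_homotopic g f.
Proof.
move=> [H [cH H0 H1 Hx Hy]].
exists (fun ts => H (clampI (valI ts.1), clampI (1 - valI ts.2))); split.
- apply: comp2_clamp_cts cH; first exact: fstI_cts.
  by move=> t; apply: cvgB; [exact: cvg_cst|exact: sndI_cts].
- by move=> t; rewrite /= valI0 valIK clampI_ge1 ?H1//; lra.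
- by move=> t; rewrite /= valI1 valIK clampI_le0 ?H0//; lra.
- by move=> s; rewrite /= valIK Hx.
- by move=> s; rewrite /= valIK Hy.
Qed.

Lemma path_homotopic_trans (x y : X) (g f h : x ~~> y) :
  path_homotopic f g -> path_homotopic g h -> path_homotopic f h.
Proof.
move=> [H [cH H0 H1 Hx Hy]] [K [cK K0 K1 Kx Ky]].
exists (fun ts => if valI ts.2 <= 2^-1
  then H (clampI (valI ts.1), clampI (2 * valI ts.2 + 0))
  else K (clampI (valI ts.1), clampI (2 * valI ts.2 + -1))); split.
- apply: paste_cts; first exact: sndI_cts.
  + by apply: comp2_clamp_cts cH; [exact: fstI_cts|exact: affine_cts].
  + by apply: comp2_clamp_cts cK; [exact: fstI_cts|exact: affine_cts].
  + move=> t ->; rewrite [X in H (_, X)]clampI_ge1; last lra.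
    by rewrite [X in K (_, X)]clampI_le0 ?H1 ?K0//; lra.
- move=> t; rewrite /= valI0 ifT; last lra.
  by rewrite valIK clampI_le0 ?H0//; lra.
- move=> t; rewrite /= valI1 ifF; last by apply/negbTE; rewrite -ltNge; lra.
  by rewrite valIK clampI_ge1 ?K1//; lra.
- by move=> s; rewrite /= !valIK Hx Kx; case: ifP.
- by move=> s; rewrite /= !valIK Hy Ky; case: ifP.
Qed.

Lemma path_homotopic_cat (x y z : X) (f f' : x ~~> y) (g g' : y ~~> z) :
  path_homotopic f f' -> path_homotopic g g' ->
  path_homotopic (path_cat f g) (path_cat f' g').
Proof.
move=> [H [cH H0 H1 Hx Hy]] [K [cK K0 K1 Kx Ky]].
exists (fun ts => if valI ts.1 <= 2^-1
  then H (clampI (2 * valI ts.1 + 0), clampI (valI ts.2))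
  else K (clampI (2 * valI ts.1 + -1), clampI (valI ts.2))); split.
- apply: paste_cts; first exact: fstI_cts.
  + by apply: comp2_clamp_cts cH; [exact: affine_cts|exact: sndI_cts].
  + by apply: comp2_clamp_cts cK; [exact: affine_cts|exact: sndI_cts].
  + move=> t ->; rewrite [X in H (X, _)]clampI_ge1; last lra.
    by rewrite [X in K (X, _)]clampI_le0 ?Hy ?Kx//; lra.
- by move=> t; rewrite /= !valIK H0 K0 addr0.
- by move=> t; rewrite /= !valIK H1 K1 addr0.
- move=> s; rewrite /= valI0 ifT; last lra.
  by rewrite clampI_le0 ?Hx//; lra.
- move=> s; rewrite /= valI1 ifF; last by apply/negbTE; rewrite -ltNge; lra.
  by rewrite clampI_ge1 ?Ky//; lra.
Qed.

Let maxD_cts (f g : I -> R) : continuous f -> continuous g ->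
  continuous (fun t => Num.max (f t) (g t)).
Proof. by move=> cf cg t; apply: (@continuous_max _ _ f g); [exact: cf|exact: cg]. Qed.

Let minD_cts (f g : I -> R) : continuous f -> continuous g ->
  continuous (fun t => Num.min (f t) (g t)).
Proof. by move=> cf cg t; apply: (@continuous_min _ _ f g); [exact: cf|exact: cg]. Qed.

Let affI_cts (a b : R) : continuous (fun t : I => a * valI t + b).
Proof. exact: affine_cts (@valI_cts R). Qed.

Lemma path_catE (x y z : X) (p : x ~~> y) (q : y ~~> z) (t : I) :
  path_cat p q t = if valI t <= 2^-1 then p (clampI (2 * valI t))
                   else q (clampI (2 * valI t - 1)).
Proof. by []. Qed.

Lemma max3P (a b c m : R) : a <= m -> b <= m -> c <= m ->
  [\/ m = a, m = b | m = c] -> Num.max a (Num.max b c) = m.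
Proof.
move=> am bm cm mabc; apply/le_anti; rewrite !ge_max am bm cm /= !le_max.
by case: mabc => <-; rewrite lexx ?orbT.
Qed.

Lemma path_catA (x y z w : X) (f : x ~~> y) (g : y ~~> z) (h : z ~~> w) :
  path_homotopic (path_cat f (path_cat g h)) (path_cat (path_cat f g) h).
Proof.
apply: (@path_reparam _ _ _ _ (path_cat (path_cat f g) h)
  (fun t => Num.max (2^-1 * valI t + 0)
     (Num.max (1 * valI t + (- 4^-1)) (2 * valI t + -1))) (@valI R)).
- exact: cts_fun.
- by apply: maxD_cts; [|apply: maxD_cts]; exact: affI_cts.
- exact: valI_cts.
- by rewrite valI0; apply: max3P; [lra|lra|lra|constructor 1; lra].
- by rewrite valI1; apply: max3P; [lra|lra|lra|constructor 3; lra].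
- move=> t; have /andP[t0 t1] := valI_itv t.
  set m := Num.max _ _; rewrite path_catE.
  case: leP => t2.
    have -> : m = 2^-1 * valI t by apply: max3P; [lra|lra|lra|constructor 1; lra].
    rewrite path_catE clampIE; last lra.
    rewrite ifT; last lra.
    rewrite path_catE clampIE; last lra.
    rewrite ifT; last lra.
    by congr (f (clampI _)); lra.
  rewrite path_catE clampIE; last lra.
  case: leP => t4.
    have -> : m = valI t - 4^-1.
      by apply: max3P; [lra|lra|lra|constructor 2; lra].
    rewrite path_catE clampIE; last lra.
    rewrite ifT; last lra.
    rewrite path_catE clampIE; last lra.
    rewrite ifF; last by apply/negbTE; rewrite -ltNge; lra.
    by congr (g (clampI _)); lra.
  have -> : m = 2 * valI t - 1.
    by apply: max3P; [lra|lra|lra|constructor 3; lra].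
  rewrite path_catE clampIE; last lra.
  rewrite ifF; last by apply/negbTE; rewrite -ltNge; lra.
  by [].
- by move=> t; rewrite valIK.
Qed.

Lemma path_cat_cstl (x y : X) (f : x ~~> y) :
  path_homotopic (path_cat (cst x) f) f.
Proof.
apply: (@path_reparam _ _ _ _ f
  (fun t => Num.max 0 (2 * valI t + -1)) (@valI R)).
- exact: cts_fun.
- by apply: maxD_cts; [exact: cst_continuous|exact: affI_cts].
- exact: valI_cts.
- by rewrite valI0 (max_idPl _)//; lra.
- by rewrite valI1 (max_idPr _)//; lra.
- move=> t; rewrite path_catE; case: leP => t2.
    by rewrite (max_idPl _) ?[in RHS]clampI_le0 ?path_zero//; lra.
  by rewrite (max_idPr _)//; lra.
- by move=> t; rewrite valIK.
Qed.

Lemma path_cat_cstr (x y : X) (f : x ~~> y) :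
  path_homotopic (path_cat f (cst y)) f.
Proof.
apply: (@path_reparam _ _ _ _ f
  (fun t => Num.min 1 (2 * valI t + 0)) (@valI R)).
- exact: cts_fun.
- by apply: minD_cts; [exact: cst_continuous|exact: affI_cts].
- exact: valI_cts.
- by rewrite valI0 (min_idPr _); lra.
- by rewrite valI1 (min_idPl _)//; lra.
- move=> t; rewrite path_catE addr0; case: leP => t2.
    by rewrite (min_idPr _)//; lra.
  by rewrite (min_idPl _) ?[in RHS]clampI_ge1 ?path_one//; lra.
- by move=> t; rewrite valIK.
Qed.

Lemma path_cat_rev (x y : X) (f : x ~~> y) :
  path_homotopic (path_cat f (path_rev f)) (cst x).
Proof.
apply: (@path_reparam _ _ _ _ f
  (fun t => Num.min (2 * valI t + 0) (-2 * valI t + 2)) (cst 0)).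
- exact: cts_fun.
- by apply: minD_cts; exact: affI_cts.
- exact: cst_continuous.
- by rewrite valI0 (min_idPl _) /=; lra.
- by rewrite valI1 (min_idPr _) /=; lra.
- move=> t; have /andP[t0 t1] := valI_itv t.
  rewrite path_catE addr0; case: leP => t2.
    by rewrite (min_idPl _)//; lra.
  rewrite (min_idPr _); last lra.
  rewrite !path_revE clampIE; last lra.
  by congr (f (clampI _)); lra.
- by move=> t; rewrite clampI_le0// path_zero.
Qed.

Lemma path_revK (x y : X) (f : x ~~> y) : path_rev (path_rev f) =1 f.
Proof.
move=> t; have /andP[t0 t1] := valI_itv t.
rewrite !path_revE clampIE; last lra.
by rewrite subKr valIK.
Qed.

Lemma path_rev_cat (x y : X) (f : x ~~> y) :
  path_homotopic (path_cat (path_rev f) f) (cst y).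
Proof.
have := path_cat_rev (path_rev f).
by have /path_eqP -> := path_revK f.
Qed.

End PathHomotopy.

Section FundamentalGroup.
Context (R : realType) (X : topologicalType) (x0 : X).
Local Notation loop := {path (unit_interval R) from x0 to x0 in X}.

Definition loop_pregroup : pregroup :=
  @Pregroup loop (@path_homotopic R X x0 x0) (@path_cat R X x0 x0 x0)
    (cst x0 : loop) (@path_rev R X x0 x0)
    (@path_homotopic_refl R X x0 x0) (@path_homotopic_sym R X x0 x0)
    (@path_homotopic_trans R X x0 x0) (@path_homotopic_cat R X x0 x0 x0)
    (@path_catA R X x0 x0 x0 x0) (@path_cat_cstl R X x0 x0)
    (@path_cat_cstr R X x0 x0) (@path_rev_cat R X x0 x0)
    (@path_cat_rev R X x0 x0).

Definition fundamental_group : groupType := pg_group loop_pregroup.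

End FundamentalGroup.

Section HyperbolicSurface.
Context (R : realType).

Definition arcosh (x : R) : R := ln (x + Num.sqrt (x ^+ 2 - 1)).

Definition upper_half_plane : set (R * R) := [set z | 0 < z.2].

(* The distance on the upper half-plane of the metric
   (dx ^ 2 + dy ^ 2) / y ^ 2; it is only meaningful on upper_half_plane. *)
Definition hyperbolic_dist (z w : R * R) : R :=
  arcosh (1 + ((z.1 - w.1) ^+ 2 + (z.2 - w.2) ^+ 2) / (2 * z.2 * w.2)).

Definition hyperbolic_ball (z : R * R) (r : R) : set (R * R) :=
  [set w | upper_half_plane w /\ hyperbolic_dist z w < r].

Definition locally_hyperbolic (X : metricType R) : Prop :=
  forall x : X, exists (r : R) (f : X -> R * R),
    [/\ 0 < r, upper_half_plane (f x),
        forall y z, ball x r y -> ball x r z ->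
          hyperbolic_dist (f y) (f z) = mdist y z
      & f @` ball x r = hyperbolic_ball (f x) r].

(* A closed surface with a Riemannian metric of constant curvature -1, seen as
   a metric space through its geodesic distance. It is nonempty wherever a
   base point is given, and need not be orientable. *)
Definition closed_hyperbolic_surface (X : metricType R) : Prop :=
  [/\ compact [set: X], connected [set: X] & locally_hyperbolic X].

Definition hyperbolic_surface_group (S : groupType) : Prop :=
  exists (X : metricType R) (x0 : X),
    closed_hyperbolic_surface X /\ group_iso S (fundamental_group R x0).

End HyperbolicSurface.

(* Main.v *)
(* Let W be the right-angled Coxeter group of the cycle, and S the subgroup of
   elements in which every generator occurs an even number of times.

   S embeds in the graph product: pick g_v <> 1 in each vertex group and read a
   word of S by turning the successive occurrences of v into g_v, g_v^-1, g_v, ...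
   This is undone by letting the graph product act on (prod_v G_v) * R^3, where
   multiplying the coordinate v reflects R^3 in the wall v exactly when that
   coordinate enters or leaves {g_v}.

   S is a surface group: W acts on the hyperboloid by reflections in the sides of
   the regular right-angled m-gon, which exists because m >= 5. Two sides which
   are not consecutive are ultraparallel, so a reduced word w sends the polygon
   to the negative side of exactly those walls which can come first in w; thus
   the action is faithful and the images of the polygon do not overlap. A descent
   on the height shows that they cover the plane. Stabilizers of points are
   generated by commuting reflections, hence meet S trivially, and by compactness
   S displaces every point by a uniform amount. The quotient of the plane by S is
   then a closed hyperbolic surface, and lifting paths and homotopies to the plane
   identifies its fundamental group with S. *)
From HB Require Import structures.
Require Import Defs.
From mathcomp Require Import all_boot all_order all_algebra.
From mathcomp Require Import all_classical all_reals all_analysis.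
From mathcomp Require Import homotopy ring lra zify.

Set Implicit Arguments.
Unset Strict Implicit.
Unset Printing Implicit Defensive.

Import Order.TTheory GRing.Theory Num.Theory.
Import numFieldNormedType.Exports.

(** * Words in a right-angled Coxeter group *)

Section RightAngledWords.
Context (V : eqType) (E : rel V).

Inductive cox_eq : seq V -> seq V -> Prop :=
| cox_refl w : cox_eq w w
| cox_sym w1 w2 : cox_eq w1 w2 -> cox_eq w2 w1
| cox_trans w2 w1 w3 : cox_eq w1 w2 -> cox_eq w2 w3 -> cox_eq w1 w3
| cox_cancel w1 w2 i : cox_eq (w1 ++ [:: i, i & w2]) (w1 ++ w2)
| cox_swap w1 w2 i j : E i j ->
    cox_eq (w1 ++ [:: i, j & w2]) (w1 ++ [:: j, i & w2]).

Lemma cox_cons i w1 w2 : cox_eq w1 w2 -> cox_eq (i :: w1) (i :: w2).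
Proof.
elim=> {w1 w2} [w1|w1 w2 _|w2 w1 w3 _ + _|w1 w2 j|w1 w2 j k jk].
- exact: cox_refl.
- exact: cox_sym.
- exact: cox_trans.
- rewrite -!cat_cons; exact: cox_cancel.
- rewrite -!cat_cons; exact: cox_swap.
Qed.

Lemma cox_cat w1 w1' w2 w2' :
  cox_eq w1 w1' -> cox_eq w2 w2' -> cox_eq (w1 ++ w2) (w1' ++ w2').
Proof.
move=> h1 h2; apply: (@cox_trans (w1' ++ w2)).
  elim: h1 => {w1 w1' w2' h2} [w1|w1 w1' _|w3 w1 w1' _ + _|w1 w1' j|w1 w1' j k jk].
  - exact: cox_refl.
  - exact: cox_sym.
  - exact: cox_trans.
  - rewrite -!catA; exact: cox_cancel.
  - rewrite -!catA; exact: cox_swap.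
by elim: w1' {h1} => //= i w IH; exact: cox_cons.
Qed.

Lemma cox_rev_cat w : cox_eq (rev w ++ w) [::].
Proof.
elim: w => [|i w IH]; first exact: cox_refl.
rewrite rev_cons cat_rcons; exact: cox_trans (cox_cancel _ _ _) IH.
Qed.

(** Each relation preserves the parity of every letter, so having only even counts is a property of
    the group element. *)
Lemma cox_count (w1 w2 : seq V) : cox_eq w1 w2 ->
  forall i, odd (count_mem i w1) = odd (count_mem i w2).
Proof.
elim=> {w1 w2} [//|w1 w2 _ IH i|w2 w1 w3 _ IH1 _ IH2 i|w1 w2 j i|w1 w2 j k _ i].
- by rewrite IH.
- by rewrite IH1.
- by rewrite !count_cat /= !oddD addKb.
- by rewrite !count_cat /= (addnCA (k == i)).
Qed.

(** An [i] can be swapped to the front: every letter before the first [i] is adjacent to it. *)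
Fixpoint descent (i : V) (w : seq V) : bool :=
  if w is j :: w' then (i == j) || (E i j && descent i w') else false.

Fixpoint reduced (w : seq V) : bool :=
  if w is i :: w' then reduced w' && ~~ descent i w' else true.

Lemma descent_front i w : descent i w ->
  exists w', [/\ cox_eq w (i :: w'), size w = (size w').+1 & {subset w' <= w}].
Proof.
elim: w => [//|j w IH] /=; case: eqP => [<- _|_ /= /andP[ij /IH[w' [ww' sw sub]]]].
  by exists w; split=> [||k kw]; [exact: cox_refl| |rewrite inE kw orbT].
exists (j :: w'); split; [|by rewrite /= sw|].
  apply: cox_trans (cox_cons j ww') _; apply: cox_sym; exact: (@cox_swap [::]).
by move=> k; rewrite !inE => /orP[->//|/sub->]; rewrite orbT.
Qed.

Lemma not_reduced_shorten w : ~~ reduced w ->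
  exists w', [/\ cox_eq w w', size w' < size w & {subset w' <= w}].
Proof.
elim: w => [//|i w IH] /=; rewrite negb_and negbK => /orP[/IH[w' [ww' s sub]]|].
  exists (i :: w'); split=> //; first exact: cox_cons.
  by move=> k; rewrite !inE => /orP[->//|/sub->]; rewrite orbT.
move=> /descent_front[w' [ww' -> sub]]; exists w'; split; last 2 first.
- by rewrite ltnS ltnW.
- by move=> k kw; rewrite inE sub ?orbT.
apply: cox_trans (cox_cons i ww') _; exact: (@cox_cancel [::]).
Qed.

Lemma reduced_exists w :
  exists w', [/\ cox_eq w w', reduced w' & {subset w' <= w}].
Proof.
have [n] := ubnP (size w); elim: n w => // n IH w; rewrite ltnS => sw.
have [rw|/not_reduced_shorten[w' [ww' sw' sub]]] := boolP (reduced w).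
  by exists w; split=> //; exact: cox_refl.
have [w2 [w'w2 r2 sub2]] := IH w' (leq_trans sw' sw).
by exists w2; split=> [||k /sub2/sub//]; [exact: cox_trans w'w2|].
Qed.

(** When all letters commute, a letter that occurs again later is a descent of what follows it,
    which reducedness forbids. *)
Lemma reduced_clique_uniq w :
  {in w &, forall i j, i != j -> E i j} -> reduced w -> uniq w.
Proof.
elim: w => [//|i w IH] cl /= /andP[rw /negP di].
have clw : {in w &, forall i j, i != j -> E i j}.
  by move=> j k jw kw; apply: cl; rewrite inE ?jw ?kw orbT.
rewrite IH // andbT; apply/negP => iw; apply: di.
elim: w cl iw {rw IH clw} => [//|j w IH] cl.
rewrite inE /=; case: eqP => //= /eqP ij iw.
rewrite cl ?inE ?eqxx ?orbT//= IH// => a b aw bw; apply: cl.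
  by move: aw; rewrite !inE => /orP[->|->]; rewrite ?orbT.
by move: bw; rewrite !inE => /orP[->|->]; rewrite ?orbT.
Qed.

(** A reduced form of [w] has distinct letters by [reduced_clique_uniq] and even counts by
    [cox_count], so it is empty. *)
Lemma even_clique_cox_nil w : {in w &, forall i j, i != j -> E i j} ->
  (forall i, ~~ odd (count_mem i w)) -> cox_eq w [::].
Proof.
move=> cl ev; have [w' [ww' rw' sub]] := reduced_exists w.
have /reduced_clique_uniq /(_ rw') uw' : {in w' &, forall i j, i != j -> E i j}.
  by move=> i j /sub iw /sub jw; exact: cl.
case: w' ww' {rw' sub} uw' => [//|i w'] ww' /count_uniq_mem => /(_ i).
by have := ev i; rewrite (cox_count ww') => /[swap] ->; rewrite mem_head.
Qed.

End RightAngledWords.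

Local Open Scope quotient_scope.
Local Open Scope classical_set_scope.
Local Open Scope ring_scope.

(** * Reflections of the hyperboloid *)

Section Lorentz.
Context (R : realType).
Local Notation vec := (R * R * R)%type.
Implicit Types p q u v : vec.

Definition lorentz p q : R := p.1.1 * q.1.1 - p.1.2 * q.1.2 - p.2 * q.2.

Definition hyperboloid p : bool := (lorentz p p == 1) && (0 < p.1.1).

(** The sign is [+] because walls are given by normals [u] of norm -1. *)
Definition lreflect u p : vec :=
  (p.1.1 + 2 * lorentz p u * u.1.1, p.1.2 + 2 * lorentz p u * u.1.2,
   p.2 + 2 * lorentz p u * u.2).

Lemma lorentzC p q : lorentz p q = lorentz q p.
Proof. rewrite /lorentz; ring. Qed.

Lemma lorentz_lreflect u p q :
  lorentz (lreflect u p) q = lorentz p q + 2 * lorentz p u * lorentz u q.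
Proof. rewrite /lreflect /lorentz /=; ring. Qed.

Lemma lreflect_isom u p q : lorentz u u = -1 ->
  lorentz (lreflect u p) (lreflect u q) = lorentz p q.
Proof.
move=> uu; transitivity
    (lorentz p q + 4 * lorentz p u * lorentz q u * (1 + lorentz u u)).
  by rewrite /lreflect /lorentz /=; ring.
by rewrite uu subrr mulr0 addr0.
Qed.

Lemma lreflectK u : lorentz u u = -1 -> involutive (lreflect u).
Proof.
move=> uu p; rewrite {1}/lreflect lorentz_lreflect uu /lreflect /=.
by case: p => [[t x] y] /=; congr (_, _, _); ring.
Qed.

Lemma lreflectC u v p : lorentz u v = 0 ->
  lreflect u (lreflect v p) = lreflect v (lreflect u p).
Proof.
move=> uv; rewrite {1}/lreflect [in RHS]/lreflect !lorentz_lreflect.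
rewrite (lorentzC v u) uv.
by rewrite /lreflect /=; congr (_, _, _); ring.
Qed.

Lemma hyperboloid1 p : hyperboloid p -> lorentz p p = 1.
Proof. by case/andP=> /eqP. Qed.

(* The Gram determinant of [p], [q], [u] is the square of the determinant of
   the matrix of their coordinates. *)
Lemma lorentz_gram p q u : lorentz p p = 1 -> lorentz q q = 1 ->
  (lorentz p u - lorentz p q * lorentz q u) ^+ 2 <=
  (lorentz p q ^+ 2 - 1) * (lorentz q u ^+ 2 - lorentz u u).
Proof.
move=> pp qq; rewrite -subr_ge0.
suff -> : (lorentz p q ^+ 2 - 1) * (lorentz q u ^+ 2 - lorentz u u) -
    (lorentz p u - lorentz p q * lorentz q u) ^+ 2 =
    (p.1.1 * (q.1.2 * u.2 - q.2 * u.1.2) - p.1.2 * (q.1.1 * u.2 - q.2 * u.1.1)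
     + p.2 * (q.1.1 * u.1.2 - q.1.2 * u.1.1)) ^+ 2 by exact: sqr_ge0.
transitivity (lorentz p p * lorentz q q * lorentz u u
   + 2 * lorentz p q * lorentz q u * lorentz p u
   - lorentz p u ^+ 2 * lorentz q q - lorentz q u ^+ 2 * lorentz p p
   - lorentz p q ^+ 2 * lorentz u u); first by rewrite pp qq; ring.
rewrite /lorentz; ring.
Qed.

(** Reverse Cauchy-Schwarz inequality. It reduces to the ordinary one for [(1, x, y)] and
    [(b, x', y')], whose defect is the sum of three squares in the proof. *)
Lemma lorentz_ge p u b : hyperboloid p -> 0 < u.1.1 -> 0 <= b ->
  b ^+ 2 <= lorentz u u -> b <= lorentz p u.
Proof.
case: p u => [[t x] y] [[t' x'] y'] /andP[].
rewrite /lorentz /= => /eqP pp t0 t'0 b0 bu.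
suff: b + (x * x' + y * y') <= t * t' by lra.
apply: real_ler_normlW; first exact: num_real.
rewrite -(ger0_norm (mulr_ge0 (ltW t0) (ltW t'0))) -ler_sqr ?nnegrE ?normr_ge0//.
rewrite !real_normK ?num_real//.
have -> : (t * t') ^+ 2 = (t * t) * (t' * t') by ring.
have -> : t * t = 1 + (x * x + y * y) by lra.
have ht : b ^+ 2 + (x' * x' + y' * y') <= t' * t' by lra.
apply: le_trans (ler_wpM2l _ ht); last first.
  by rewrite addr_ge0 ?ler01 ?addr_ge0// -expr2 sqr_ge0.
rewrite -subr_ge0; have -> : (1 + (x * x + y * y)) * (b ^+ 2 + (x' * x' + y' * y'))
    - (b + (x * x' + y * y')) ^+ 2 =
  (x' - b * x) ^+ 2 + (y' - b * y) ^+ 2 + (x * y' - y * x') ^+ 2 by ring.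
by rewrite !addr_ge0 ?sqr_ge0.
Qed.

Lemma lorentz_ge1 p q : hyperboloid p -> hyperboloid q -> 1 <= lorentz p q.
Proof.
move=> hp hq; apply: lorentz_ge => //; first by case/andP: hq.
by rewrite hyperboloid1// expr1n.
Qed.

Lemma hyperboloid_ge1 p : hyperboloid p -> 1 <= p.1.1.
Proof.
move=> hp; have -> : p.1.1 = lorentz p (1, 0, 0) by rewrite /lorentz /=; ring.
apply: lorentz_ge1 => //; rewrite /hyperboloid /lorentz /= ltr01 andbT.
apply/eqP; ring.
Qed.

(** The bound in [lorentz_gram] vanishes, so [p] and [q] have the same product with every vector, in
    particular with a basis. *)
Lemma lorentz_eq1 p q : hyperboloid p -> hyperboloid q -> lorentz p q = 1 -> p = q.
Proof.
move=> hp hq pq.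
have coord u : lorentz p u = lorentz q u.
  have := lorentz_gram u (hyperboloid1 hp) (hyperboloid1 hq).
  rewrite pq expr1n subrr mul0r mul1r => h; apply/eqP; rewrite -subr_eq0 -sqrf_eq0.
  by rewrite eq_le h sqr_ge0.
have := coord (1, 0, 0); have := coord (0, 1, 0); have := coord (0, 0, 1).
by rewrite /lorentz; case: p q {hp hq pq coord} => [[a b] c] [[a' b'] c'] /= ? ? ?;
  congr (_, _, _); lra.
Qed.

(** The norm is preserved; the point is to exclude the lower sheet. The product of [p] with its
    image is [1 + 2 * lorentz p u ^+ 2 > 0], while points of the lower sheet have product at most -1
    with [p]. *)
Lemma hyperboloid_lreflect u p : lorentz u u = -1 -> hyperboloid p ->
  hyperboloid (lreflect u p).
Proof.
move=> uu hp; have pp := hyperboloid1 hp.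
rewrite /hyperboloid lreflect_isom// pp eqxx andTb.
have pq : 0 < lorentz p (lreflect u p).
  rewrite lorentzC lorentz_lreflect pp (lorentzC u) -mulrA -expr2.
  by have := sqr_ge0 (lorentz p u); lra.
have qq : lorentz (lreflect u p) (lreflect u p) = 1 by rewrite lreflect_isom.
move: pq qq; move: (lreflect u p) => q pq qq; rewrite ltNge; apply/negP => q0.
have hq : hyperboloid (- q.1.1, - q.1.2, - q.2).
  rewrite /hyperboloid; apply/andP; split.
    by apply/eqP; rewrite -qq /lorentz /=; ring.
  rewrite /= oppr_gt0 lt_neqAle q0 andbT; apply/eqP => q00.
  move: qq; rewrite /lorentz q00 => qq.
  by have := sqr_ge0 q.1.2; have := sqr_ge0 q.2; rewrite !expr2; lra.
have := lorentz_ge1 hp hq.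
have -> : lorentz p (- q.1.1, - q.1.2, - q.2) = - lorentz p q.
  by rewrite /lorentz /=; ring.
lra.
Qed.

End Lorentz.

(** * The group generated by the reflections in the walls *)

Section ReflectionGroup.
Context (R : realType) (V : finType) (E : rel V).
Context (e : V -> R * R * R) (eta height bound : R).
Local Notation vec := (R * R * R)%type.
Implicit Types (p q : vec) (w : seq V) (i j : V).

Definition word_act w p : vec := foldr (fun i => lreflect (e i)) p w.

Definition chamber p : Prop := hyperboloid p /\ forall i, 0 <= lorentz p (e i).

(* In [e_apart], [e i + e j] is timelike: the lines [i] and [j] are
   ultraparallel, and no point lies beyond both of them. *)
Hypothesis e_norm : forall i, lorentz (e i) (e i) = -1.
Hypothesis e_orth : forall i j, E i j -> lorentz (e i) (e j) = 0.
Hypothesis eta_gt0 : 0 < eta.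
Hypothesis e_apart : forall i j p, i != j -> ~~ E i j -> hyperboloid p ->
  eta <= lorentz p (e i) + lorentz p (e j).
Hypothesis e_height : forall i, (e i).1.1 = height.
Hypothesis height_gt0 : 0 < height.
Hypothesis e_bound : forall p i, chamber p -> lorentz p (e i) <= bound.

Lemma word_act_cat w1 w2 p : word_act (w1 ++ w2) p = word_act w1 (word_act w2 p).
Proof. by rewrite /word_act foldr_cat. Qed.

Lemma word_act_isom w p q : lorentz (word_act w p) (word_act w q) = lorentz p q.
Proof. by elim: w => //= i w IH; rewrite lreflect_isom. Qed.

Lemma word_act_hyperboloid w p : hyperboloid p -> hyperboloid (word_act w p).
Proof. by move=> hp; elim: w => //= i w IH; exact: hyperboloid_lreflect. Qed.

Lemma word_act_rev w : cancel (word_act w) (word_act (rev w)).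
Proof.
elim: w => //= i w IH p.
by rewrite rev_cons -cats1 word_act_cat /= lreflectK.
Qed.

Lemma word_act_revK w : cancel (word_act (rev w)) (word_act w).
Proof. by move=> p; rewrite -{1}(revK w) word_act_rev. Qed.

Lemma cox_act w1 w2 : cox_eq E w1 w2 -> word_act w1 =1 word_act w2.
Proof.
elim=> {w1 w2} [//|w1 w2 _ IH p|w2 w1 w3 _ IH1 _ IH2 p|w1 w2 i p|w1 w2 i j ij p].
- by rewrite IH.
- by rewrite IH1.
- by rewrite !word_act_cat /= lreflectK.
- by rewrite !word_act_cat /= lreflectC// e_orth.
Qed.

Lemma lorentz_lreflectE p i : lorentz (lreflect (e i) p) (e i) = - lorentz p (e i).
Proof. rewrite lorentz_lreflect e_norm; ring. Qed.

Lemma lorentz_lreflect_adj p i j : E i j ->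
  lorentz (lreflect (e i) p) (e j) = lorentz p (e j).
Proof. move=> ij; rewrite lorentz_lreflect e_orth//; ring. Qed.

Hypothesis E_sym : symmetric E.

(** Induction on [w]. The leading letter [j] puts the point on the nonpositive side of wall [j]. If
    [i] is adjacent to [j], the product with [e i] does not change; if [i] is neither [j] nor
    adjacent to it, [e_apart] forces the positive side of wall [i]. *)
Lemma reduced_sign w p i : chamber p -> reduced E w ->
  if descent E i w then lorentz (word_act w p) (e i) <= 0
  else 0 <= lorentz (word_act w p) (e i).
Proof.
move=> [hp Cp]; elim: w i => [|j w IH] i /= => [_|/andP[rw dj]]; first exact: Cp.
have := IH j rw; rewrite (negbTE dj) => j0.
have [->|ij /=] := eqVneq i j; first by rewrite lorentz_lreflectE oppr_le0.
have [Eij|nEij] /= := boolP (E i j).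
  by rewrite lorentz_lreflect_adj 1?E_sym//; exact: IH.
have hq : hyperboloid (lreflect (e j) (word_act w p)).
  exact: (@word_act_hyperboloid (j :: w)).
have := e_apart ij nEij hq; rewrite lorentz_lreflectE; move: eta_gt0 j0.
by move: (lorentz _ _) (lorentz _ _) => a b *; lra.
Qed.

(** The same induction from an interior point of the chamber, where the signs are strict, as
    faithfulness requires. *)
Lemma reduced_sign_strict w p i :
  hyperboloid p -> (forall i, 0 < lorentz p (e i)) -> reduced E w ->
  if descent E i w then lorentz (word_act w p) (e i) < 0
  else 0 < lorentz (word_act w p) (e i).
Proof.
move=> hp Cp; elim: w i => [|j w IH] i /= => [_|/andP[rw dj]]; first exact: Cp.
have := IH j rw; rewrite (negbTE dj) => j0.
have [->|ij /=] := eqVneq i j; first by rewrite lorentz_lreflectE oppr_lt0.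
have [Eij|nEij] /= := boolP (E i j).
  by rewrite lorentz_lreflect_adj 1?E_sym//; exact: IH.
have hq : hyperboloid (lreflect (e j) (word_act w p)).
  exact: (@word_act_hyperboloid (j :: w)).
have := e_apart ij nEij hq; rewrite lorentz_lreflectE; move: eta_gt0 j0.
by move: (lorentz _ _) (lorentz _ _) => a b *; lra.
Qed.

Lemma center_lorentz i : lorentz (1, 0, 0) (e i) = height.
Proof. by rewrite /lorentz /= e_height; ring. Qed.

Lemma center_hyperboloid : hyperboloid ((1, 0, 0) : vec).
Proof. rewrite /hyperboloid /lorentz /= ltr01 andbT; apply/eqP; ring. Qed.

(** If a reduced form began with a letter [i], the image of the center would lie strictly beyond
    wall [i], and the center does not. *)
Lemma word_act_faithful w :
  word_act w (1, 0, 0) = (1, 0, 0) -> cox_eq E w [::].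
Proof.
have [w' [ww' rw' _]] := reduced_exists E w; rewrite (cox_act ww').
case: w' ww' rw' => [//|i w'] _ rw' act1.
have C0 j : 0 < lorentz ((1, 0, 0) : vec) (e j) by rewrite center_lorentz.
have := reduced_sign_strict i center_hyperboloid C0 rw'.
by rewrite [descent E i _]/= eqxx act1 center_lorentz ltNge ltW.
Qed.

(** For the first letter [i], [reduced_sign] and the chamber condition together put the image on
    wall [i]. The reflection in [i] then fixes it and can be peeled off. *)
Lemma reduced_stab w p : chamber p -> chamber (word_act w p) -> reduced E w ->
  word_act w p = p /\ forall i, i \in w -> lorentz p (e i) = 0.
Proof.
move=> Cp; elim: w => [//|i w IH] Cwp rw.
have := reduced_sign i Cp rw; rewrite [descent E i _]/= eqxx /= => le0.
have /= wpi0 : lorentz (word_act (i :: w) p) (e i) = 0.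
  by apply/eqP; rewrite eq_le le0/=; case: Cwp.
move: wpi0; rewrite lorentz_lreflectE => /eqP; rewrite oppr_eq0 => /eqP wpi0.
have fixi : lreflect (e i) (word_act w p) = word_act w p.
  rewrite /lreflect wpi0 mulr0 !mul0r !addr0.
  by case: (word_act w p) => [[]].
move: Cwp rw => /=; rewrite fixi => Cwp /andP[rw _]; have [wp Hw] := IH Cwp rw.
by split=> // j; rewrite inE => /orP[/eqP->|/Hw//]; rewrite -wp.
Qed.

(** Reflect in a wall [i] that [q] is beyond. Adjacent walls keep their products; for any other wall
    [j], the product with [e i] is now at most [eta], so [e_apart] makes the product with [e j]
    nonnegative. No new wall is violated and [i] is repaired, so the number of violated walls
    drops. *)
Lemma near_chamber q : hyperboloid q -> (forall i, - eta <= lorentz q (e i)) ->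
  exists2 a, chamber (word_act a q) & forall i, i \in a -> lorentz q (e i) < 0.
Proof.
have [n] := ubnP #|[pred i | lorentz q (e i) < 0]|.
elim: n q => // n IH q; rewrite ltnS => qn hq qeta.
have [/existsP[i qi]|/existsPn nq] := boolP [exists i, lorentz q (e i) < 0];
    last first.
  by exists [::] => //; split => // i; rewrite leNgt; exact: nq.
have hq' := hyperboloid_lreflect (e_norm i) hq.
have neg j : lorentz (lreflect (e i) q) (e j) < 0 ->
    j != i /\ lorentz q (e j) < 0.
  have [->|ji] := eqVneq j i; first by rewrite lorentz_lreflectE oppr_lt0 ltNge ltW.
  have [Eij|nEij] := boolP (E i j); first by rewrite lorentz_lreflect_adj.
  rewrite eq_sym in ji; have := e_apart ji nEij hq'; rewrite lorentz_lreflectE.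
  by have := qeta i; move: (lorentz _ _) (lorentz _ _) => *; exfalso; lra.
have [|j|a Ca aneg] := IH (lreflect (e i) q) _ hq'.
- apply: leq_trans qn; apply: proper_card; apply/properP; split.
    by apply/fintype.subsetP => j; rewrite !inE => /neg[].
  by exists i; rewrite ?inE//; apply/negP => /neg[]; rewrite eqxx.
- have := qeta j; have [/neg[ji jneg]|] := ltP (lorentz (lreflect (e i) q) (e j)) 0;
    last by move: eta_gt0; move: (lorentz _ _) => *; lra.
  have [Eij|nEij] := boolP (E i j); first by rewrite lorentz_lreflect_adj.
  rewrite eq_sym in ji; have := e_apart ji nEij hq'; rewrite lorentz_lreflectE.
  by have := qeta i; move: eta_gt0; move: (lorentz _ _) (lorentz _ _) => *; lra.
exists (rcons a i); first by rewrite -cats1 word_act_cat.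
move=> j; rewrite mem_rcons inE => /orP[/eqP->//|/aneg/neg[]//].
Qed.

(* Reflecting [q] in a wall at depth more than [eta] lowers its first coordinate,
   which is at least 1, by at least [2 * eta * height]. *)
Lemma chamber_exists q : hyperboloid q -> exists w, chamber (word_act w q).
Proof.
move=> hq; pose d := 2 * eta * height; have d0 : 0 < d by rewrite !mulr_gt0.
have [n] : exists n : nat, q.1.1 < n%:R * d.
  exists (Num.bound (q.1.1 / d)); rewrite -ltr_pdivrMr//; apply: archi_boundP.
  by rewrite divr_ge0 ?(ltW d0)//; have := hyperboloid_ge1 hq; lra.
elim: n q hq => [|n IH] q hq qn.
  by have := hyperboloid_ge1 hq; move: qn; rewrite mul0r; lra.
have [/forallP qeta|/forallPn[i]] := boolP [forall i, - eta <= lorentz q (e i)].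
  by have [a] := near_chamber hq qeta; exists a.
rewrite -ltNge => qi; have hq' := hyperboloid_lreflect (e_norm i) hq.
have [|w] := IH (lreflect (e i) q) hq'; last first.
  by move=> Cw; exists (rcons w i); rewrite -cats1 word_act_cat.
rewrite /lreflect /= e_height; move: qn; rewrite -natr1 mulrDl mul1r /d.
have := ltr_pM2r height_gt0 (lorentz q (e i)) (- eta); rewrite qi => ?.
lra.
Qed.

(* If [w] moves a point [q] of the chamber very little, then the letters of a word
   equal to [w] all stand for walls close to [q], hence commute pairwise. *)
Lemma chamber_displacement : exists2 k0, 1 < k0 &
  forall w q, (forall i, ~~ odd (count_mem i w)) -> chamber q ->
    lorentz q (word_act w q) < k0 -> word_act w =1 id.
Proof.
(* [M] bounds [lorentz q (e i) ^+ 2 + 1] on the chamber. A product [c < 1 + k <= 2] of [q] with its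
   image has [c ^+ 2 - 1 <= 3 * k], and [k] is chosen so that the error in [lorentz_gram], at most
   [3 * k * M], stays below [(eta / 3) ^+ 2]. *)
pose M := bound ^+ 2 + 1; have M0 : 0 < M by rewrite ltr_wpDl ?sqr_ge0.
pose k := Num.min 1 (eta ^+ 2 / (27 * M)).
have k0 : 0 < k by rewrite lt_min ltr01 divr_gt0 ?exprn_gt0 ?mulr_gt0.
have k1 : k <= 1 by rewrite ge_min lexx.
have kM : 3 * k * M <= (eta / 3) ^+ 2.
  have : k <= eta ^+ 2 / (27 * M) by rewrite ge_min lexx orbT.
  by rewrite ler_pdivlMr ?mulr_gt0// expr_div_n; lra.
exists (1 + k) => [|w q ev Cq wq]; first by rewrite ltrDl.
have hq : hyperboloid q by case: Cq.
have hq' := word_act_hyperboloid w hq; set q' := word_act w q in wq hq'.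
have close i : `|lorentz q' (e i) - lorentz q' q * lorentz q (e i)| <= eta / 3.
  have eta3 : 0 <= eta / 3 by rewrite divr_ge0// ltW.
  rewrite -ler_sqr ?nnegrE ?normr_ge0// real_normK ?num_real//.
  apply: le_trans (lorentz_gram _ (hyperboloid1 hq') (hyperboloid1 hq)) _.
  apply: (le_trans _ kM); rewrite e_norm opprK lorentzC.
  have := lorentz_ge1 hq hq'; have : 0 <= lorentz q (e i) by case: Cq.
  have := e_bound i Cq; move: wq.
  move: (lorentz q q') (lorentz q (e i)) => c b cl bM b0 c1.
  apply: ler_pM.
  - by rewrite subr_ge0 -{1}(expr1n R 2) ler_sqr ?nnegrE//; lra.
  - by rewrite addr_ge0 ?sqr_ge0.
  - rewrite -{1}(expr1n R 2) subr_sqr; apply: le_trans (_ : k * 3 <= _); last lra.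
    by apply: ler_pM; lra.
  - by rewrite lerD2r ler_sqr ?nnegrE// (le_trans b0).
have c1 : 1 <= lorentz q' q by exact: lorentz_ge1.
have [i|a Ca aneg] := near_chamber hq'.
  have := close i; rewrite ler_norml => /andP[+ _].
  have : 0 <= lorentz q' q * lorentz q (e i).
    by rewrite mulr_ge0 ?(le_trans ler01 c1)//; case: Cq.
  move: eta_gt0; move: (lorentz q' q * lorentz q (e i)) (lorentz q' (e i)) => *.
  lra.
(* The letters of [a] are walls that [q'] is beyond and [q] is not, so [q] must be close to them. *)
have asmall i : i \in a -> lorentz q (e i) <= eta / 3.
  move=> /aneg; have := close i; rewrite ler_norml => /andP[+ _].
  have : lorentz q (e i) <= lorentz q' q * lorentz q (e i).
    by rewrite ler_peMl//; case: Cq.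
  by move: (lorentz q' q * lorentz q (e i)) (lorentz q' (e i)) => *; lra.
have [r [awr rr _]] := reduced_exists E (a ++ w).
have aq' : word_act a q' = word_act r q by rewrite -(cox_act awr) word_act_cat.
rewrite aq' in Ca; have [rq rwall] := reduced_stab Cq Ca rr.
have small i : i \in rev a ++ r -> lorentz q (e i) <= eta / 3.
  rewrite mem_cat mem_rev => /orP[/asmall//|/rwall->].
  by rewrite divr_ge0// ltW.
(* [rev a ++ r] is equal to [w] in the Coxeter group. Two distinct non-adjacent letters would have
   products with sum at most [2 * eta / 3], against [e_apart]; so the letters commute pairwise and
   evenness kills the word. *)
have /cox_act triv : cox_eq E (rev a ++ r) [::].
  apply: even_clique_cox_nil => [i j ib jb ij|i].
    apply/negP => /negP nE; have := e_apart ij nE hq.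
    by have := small _ ib; have := small _ jb; move: eta_gt0; lra.
  rewrite count_cat count_rev oddD -(cox_count awr) count_cat oddD.
  by rewrite (negbTE (ev i)) addbF addbb.
move=> p; rewrite -[RHS]/(word_act [::] p) -triv word_act_cat -(cox_act awr).
by rewrite word_act_cat word_act_rev.
Qed.

(** Conjugation by a word [u] that brings [q] into the chamber preserves parities and displacement,
    which reduces to [chamber_displacement]. *)
Lemma displacement : exists2 k0, 1 < k0 &
  forall w q, (forall i, ~~ odd (count_mem i w)) -> hyperboloid q ->
    lorentz q (word_act w q) < k0 -> word_act w =1 id.
Proof.
have [k0 k01 H] := chamber_displacement; exists k0 => // w q ev hq wq.
have [u Cu] := chamber_exists hq.
have triv : word_act (u ++ w ++ rev u) =1 id.
  apply: H Cu _ => [i|].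
    by rewrite !count_cat count_rev !oddD addbCA addbb addbF.
  by rewrite !word_act_cat word_act_rev word_act_isom.
by move=> p; have := triv (word_act u p);
  rewrite !word_act_cat word_act_rev => /(can_inj (word_act_rev u)).
Qed.

End ReflectionGroup.

(** * The regular right-angled polygon *)

Section RegularPolygon.
Context (R : realType) (m : nat) (hm : (5 <= m)%N).
Local Notation E := (@cycle_graph m).

Definition polygon_step : R := pi *+ 2 / m%:R.
Definition polygon_cos : R := cos polygon_step.
Definition polygon_height : R := Num.sqrt (polygon_cos / (1 - polygon_cos)).
Definition polygon_radius : R := Num.sqrt (1 - polygon_cos)^-1.
Definition polygon_angle (k : nat) : R := k%:R * polygon_step.

Local Notation delta := polygon_step.
Local Notation c := polygon_cos.
Local Notation height := polygon_height.
Local Notation radius := polygon_radius.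
Local Notation angle := polygon_angle.

(* [polygon_height] and [polygon_radius] make the Lorentz norm of the walls -1 and
   the product of two consecutive walls 0. *)
Definition polygon_wall (i : 'I_m) : R * R * R :=
  (height, radius * cos (angle i), radius * sin (angle i)).

Let m0 : (0 : R) < m%:R. Proof. by rewrite ltr0n; lia. Qed.

Let delta_m : m%:R * delta = pi *+ 2.
Proof. by rewrite /polygon_step mulrC divfK// gt_eqF. Qed.

Let delta_gt0 : 0 < delta.
Proof. by rewrite divr_gt0// mulrn_wgt0// pi_gt0. Qed.

(** Here [5 <= m] is decisive: for [m = 4] the step is exactly [pi / 2], where [polygon_cos] and
    with it [polygon_height] vanish. *)
Let delta_lt_pihalf : delta < pi / 2.
Proof.
have := pi_gt0 R; have : (5 : R) <= m%:R by rewrite ler_nat.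
by move: delta_gt0 delta_m; rewrite mulr2n; nra.
Qed.

Let c_gt0 : 0 < c.
Proof.
rewrite cos_gt0_pihalf// delta_lt_pihalf andbT.
by have := pi_gt0 R; move: delta_gt0; lra.
Qed.

Let c_lt1 : c < 1.
Proof.
rewrite -(cos0 R) ltr_cos// in_itv /=; first by rewrite lexx pi_ge0.
by move: delta_gt0 delta_lt_pihalf; have := pi_gt0 R; lra.
Qed.

Let height2 : height ^+ 2 = c / (1 - c).
Proof. by rewrite sqr_sqrtr// divr_ge0// ?subr_ge0 ltW. Qed.

Let radius2 : radius ^+ 2 = (1 - c)^-1.
Proof. by rewrite sqr_sqrtr// invr_ge0 subr_ge0 ltW. Qed.

Let height_gt0 : 0 < height.
Proof. by rewrite sqrtr_gt0 divr_gt0// subr_gt0. Qed.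

Let radius_gt0 : 0 < radius.
Proof. by rewrite sqrtr_gt0 invr_gt0 subr_gt0. Qed.

Let c1 : 1 - c != 0. Proof. by rewrite subr_eq0 gt_eqF. Qed.

Lemma polygon_wallE i j : lorentz (polygon_wall i) (polygon_wall j) =
  (c - cos (angle i - angle j)) / (1 - c).
Proof.
rewrite /lorentz /polygon_wall /= -expr2 height2 cosB.
transitivity (c / (1 - c) - radius ^+ 2 *
  (cos (angle i) * cos (angle j) + sin (angle i) * sin (angle j))); first ring.
rewrite radius2; ring.
Qed.

Lemma angle_ordS (i : 'I_m) :
  cos (angle (ordS i)) = cos (angle i + delta) /\
  sin (angle (ordS i)) = sin (angle i + delta).
Proof.
have -> : angle i + delta = angle i.+1.
  by rewrite /polygon_angle -natr1 mulrDl mul1r.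
rewrite /=; have [im|im] := ltnP i.+1 m; first by rewrite modn_small.
have -> : i.+1 = m by have := ltn_ord i; lia.
by rewrite modnn /polygon_angle delta_m mul0r cos0 sin0 cos2pi sin2pi.
Qed.

Lemma polygon_norm i : lorentz (polygon_wall i) (polygon_wall i) = -1.
Proof. rewrite polygon_wallE subrr cos0 -opprB mulNr divff//. Qed.

Lemma polygon_orth i j : E i j -> lorentz (polygon_wall i) (polygon_wall j) = 0.
Proof.
suff ortho k : lorentz (polygon_wall k) (polygon_wall (ordS k)) = 0.
  by move=> /orP[/eqP->|/eqP->]; rewrite ?ortho// lorentzC ortho.
rewrite polygon_wallE cosB; have [-> ->] := angle_ordS k.
by rewrite -cosB opprD addrA subrr add0r cosN subrr mul0r.
Qed.

(** The bound is the cosine of two steps. Cosine decreases on [[0, pi]], and an angle beyond half a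
    turn is replaced by that of [m - d] steps. *)
Lemma cos_angle_le (d : nat) : (2 <= d)%N -> (d + 2 <= m)%N ->
  cos (angle d) <= 2 * c ^+ 2 - 1.
Proof.
have half (k : nat) : (2 <= k)%N -> (k * 2 <= m)%N ->
    cos (angle k) <= 2 * c ^+ 2 - 1.
  move=> k2 km; have -> : 2 * c ^+ 2 - 1 = cos (angle 2).
    by rewrite /polygon_angle [2%:R * delta]mulr_natl cos_mulr2n -/c mulr_natl.
  have kpi : angle k <= pi.
    have : (k * 2)%:R * delta <= m%:R * delta by rewrite ler_pM2r// ler_nat.
    by rewrite delta_m natrM mulr2n /polygon_angle; lra.
  have k2a : angle 2 <= angle k by rewrite ler_pM2r// ler_nat.
  have a2 : 0 <= angle 2 by rewrite mulr_ge0// ltW.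
  have [<-//|ne] := eqVneq (angle 2) (angle k).
  by rewrite ltW// ltr_cos ?in_itv/= ?lt_neqAle ?ne//; apply/andP; split; lra.
move=> d2 dm; have [|dm'] := leqP (d * 2) m; first exact: half.
have -> : cos (angle d) = cos (angle (m - d)).
  rewrite /polygon_angle natrB; last lia.
  by rewrite mulrBl delta_m -[RHS]cosN opprB -[RHS]cosD2pi subrK.
apply: half; lia.
Qed.

(** Non-adjacent walls are at least two steps apart both ways round, and [c - (2 * c ^+ 2 - 1) = (1
    - c) * (1 + 2 * c)]. *)
Lemma polygon_far i j : i != j -> ~~ E i j ->
  1 + 2 * c <= lorentz (polygon_wall i) (polygon_wall j).
Proof.
wlog ij : i j / (i < j)%N.
  move=> H ne; have := ne; rewrite neq_ltn => /orP[lt|lt]; first exact: H.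
  by rewrite lorentzC /cycle_graph orbC; apply: H => //; rewrite eq_sym.
move=> _; rewrite negb_or => /andP[n1 n2].
have jm := ltn_ord j.
have ij1 : (i.+1 != j)%N.
  move: n1; apply: contra => /eqP h; apply/eqP/val_inj => /=.
  by rewrite modn_small h.
have ijm : ~~ ((i == 0 :> nat) && (j.+1 == m)).
  apply: contra n2 => /andP[/eqP i0 /eqP h]; apply/eqP/val_inj => /=.
  by rewrite h modnn.
rewrite polygon_wallE ler_pdivlMr ?subr_gt0//.
have -> : cos (angle i - angle j) = cos (angle (j - i)).
  by rewrite /polygon_angle natrB 1?ltnW// mulrBl -cosN opprB.
suff: cos (angle (j - i)) <= 2 * c ^+ 2 - 1.
  by move: (cos _) => x; rewrite expr2; lra.
by apply: cos_angle_le; lia.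
Qed.

Definition polygon_gap : R := 2 * Num.sqrt c.

Lemma polygon_gap_gt0 : 0 < polygon_gap.
Proof. by rewrite mulr_gt0// sqrtr_gt0. Qed.

(** The sum of the two walls has norm at least [- 2 + 2 * (1 + 2 * c) = 4 * c], the square of
    [polygon_gap], and [lorentz_ge] applies to it. *)
Lemma polygon_apart i j p : i != j -> ~~ E i j -> hyperboloid p ->
  polygon_gap <= lorentz p (polygon_wall i) + lorentz p (polygon_wall j).
Proof.
move=> ij nE hp; pose u := (polygon_wall i) ; pose v := (polygon_wall j).
have -> : lorentz p u + lorentz p v =
    lorentz p (u.1.1 + v.1.1, u.1.2 + v.1.2, u.2 + v.2).
  by rewrite /lorentz /=; ring.
apply: lorentz_ge => //; first by rewrite addr_gt0.
  exact: ltW polygon_gap_gt0.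
have -> : lorentz (u.1.1 + v.1.1, u.1.2 + v.1.2, u.2 + v.2)
    (u.1.1 + v.1.1, u.1.2 + v.1.2, u.2 + v.2) =
    lorentz u u + lorentz v v + 2 * lorentz u v by rewrite /lorentz /=; ring.
rewrite !polygon_norm /polygon_gap exprMn sqr_sqrtr ?(ltW c_gt0)//.
have := polygon_far ij nE; rewrite -/u -/v expr2; lra.
Qed.

Lemma polygon_height_gt0 : 0 < height.
Proof. exact: height_gt0. Qed.

Lemma sqr_rotation (x y a : R) : x ^+ 2 + y ^+ 2 =
  (x * cos a + y * sin a) ^+ 2 + (y * cos a - x * sin a) ^+ 2.
Proof.
transitivity ((x ^+ 2 + y ^+ 2) * (cos a ^+ 2 + sin a ^+ 2)); last ring.
by rewrite cos2Dsin2 mulr1.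
Qed.

(** The bound is attained at the vertices. Take the wall [i] in whose direction [p] reaches
    furthest. Comparison with its two neighbours bounds the transverse component [g] by [f i], the
    inequality of wall [i] bounds [f i] by the height, and the norm equation turns both into a bound
    on the height. *)
Lemma chamber_height p : chamber polygon_wall p -> p.1.1 ^+ 2 <= (1 + c) / (1 - c).
Proof.
case=> hp Cp; pose f i := p.1.2 * cos (angle i) + p.2 * sin (angle i).
have fE (i : 'I_m) : lorentz p (polygon_wall i) = height * p.1.1 - radius * f i.
  by rewrite /lorentz /f /=; ring.
have i0 : 'I_m by exists 0%N; lia.
have [i _ imax] := @arg_maxP _ _ _ i0 xpredT (fun i : 'I_m => f i) isT.
have fi (j : 'I_m) : f j <= f i by exact: (imax j isT).
pose g := p.2 * cos (angle i) - p.1.2 * sin (angle i).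
pose s := sin delta.
have fS : f (ordS i) = c * f i + s * g.
  rewrite /f; have [-> ->] := angle_ordS i.
  by rewrite cosD sinD /g /s /polygon_cos; ring.
have fP : f (ord_pred i) = c * f i - s * g.
  have [] := angle_ordS (ord_pred i); rewrite ord_predK.
  set a := angle (ord_pred i) => ci si; rewrite /f /g ci si cosD sinD -/c -/s -/a.
  transitivity ((p.1.2 * cos a + p.2 * sin a) * (c ^+ 2 + s ^+ 2)); last ring.
  by rewrite cos2Dsin2 mulr1.
have := fi (ordS i); have := fi (ord_pred i); rewrite fS fP => le1 le2.
have f0 : 0 <= f i by move: c_lt1 le1 le2; nra.
have g2 : (1 + c) * g ^+ 2 <= (1 - c) * f i ^+ 2.
  have : (s * g) ^+ 2 <= ((1 - c) * f i) ^+ 2.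
    rewrite -[leLHS]real_normK ?num_real// ler_sqr ?nnegrE//.
      by rewrite ler_norml; apply/andP; split; lra.
    by rewrite mulr_ge0// subr_ge0 ltW.
  rewrite !exprMn /s sin2cos2 -/c => h.
  rewrite -(@ler_pM2l _ (1 - c)) ?subr_gt0//.
  by move: h; rewrite !expr2; lra.
have nrm : p.1.2 ^+ 2 + p.2 ^+ 2 = f i ^+ 2 + g ^+ 2 by exact: sqr_rotation.
have pp : p.1.1 ^+ 2 = 1 + (f i ^+ 2 + g ^+ 2).
  by rewrite -nrm; have := hyperboloid1 hp; rewrite /lorentz !expr2; lra.
have p0 : 0 <= p.1.1 by have := hyperboloid_ge1 hp; lra.
have ft : f i ^+ 2 <= c * p.1.1 ^+ 2.
  have := Cp i; rewrite fE subr_ge0 => h.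
  have : (radius * f i) ^+ 2 <= (height * p.1.1) ^+ 2.
    by rewrite ler_sqr ?nnegrE// mulr_ge0// ltW.
  rewrite !exprMn height2 radius2 mulrAC [X in X <= _]mulrC.
  by rewrite ler_pM2r// invr_gt0 subr_gt0.
rewrite ler_pdivlMr ?subr_gt0//; nra.
Qed.

Lemma lorentz_polygon_le p i : hyperboloid p ->
  lorentz p (polygon_wall i) <= (height + radius) * p.1.1.
Proof.
move=> hp; have p1 := hyperboloid_ge1 hp.
pose f := p.1.2 * cos (angle i) + p.2 * sin (angle i).
have -> : lorentz p (polygon_wall i) = height * p.1.1 - radius * f.
  by rewrite /lorentz /f /=; ring.
rewrite mulrDl lerD2l -mulrN ler_pM2l//.
suff: `|f| <= p.1.1 by rewrite ler_norml; lra.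
rewrite -ler_sqr ?nnegrE//; last lra.
rewrite real_normK ?num_real//.
pose g := p.2 * cos (angle i) - p.1.2 * sin (angle i).
have nrm : p.1.2 ^+ 2 + p.2 ^+ 2 = f ^+ 2 + g ^+ 2 by exact: sqr_rotation.
have := hyperboloid1 hp; have := sqr_ge0 g; move: nrm.
by rewrite /lorentz !expr2; lra.
Qed.

(** For compactness of the surface: a bounded number of reflections multiplies the height by a
    bounded factor. *)
Lemma polygon_lreflect_height : exists2 l, 1 <= l & forall i p, hyperboloid p ->
  (lreflect (polygon_wall i) p).1.1 <= l * p.1.1.
Proof.
have hr0 : 0 <= height + radius by rewrite addr_ge0 ?ltW.
exists (1 + 2 * height * (height + radius)) => [|i p hp].
  by rewrite lerDl !mulr_ge0// ltW.
have := ler_wpM2l (ltW height_gt0) (lorentz_polygon_le i hp).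
rewrite /lreflect /=; lra.
Qed.

Lemma polygon_chamber_height : exists t, forall p,
  chamber polygon_wall p -> p.1.1 <= t.
Proof.
exists ((1 + c) / (1 - c)) => p Cp; apply: le_trans (chamber_height Cp).
have : 1 <= p.1.1 by case: Cp => /hyperboloid_ge1.
by move=> p1; rewrite expr2 ler_peMr//; lra.
Qed.

Lemma polygon_chamber_lorentz : exists b, forall p i, chamber polygon_wall p ->
  lorentz p (polygon_wall i) <= b.
Proof.
have [t Ht] := polygon_chamber_height; exists ((height + radius) * t) => p i Cp.
apply: le_trans (lorentz_polygon_le i _) _; first by case: Cp.
by rewrite ler_wpM2l ?Ht// addr_ge0 ?ltW.
Qed.

Lemma cycle_graph_sym : symmetric E.
Proof. by move=> i j; rewrite /cycle_graph orbC. Qed.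

End RegularPolygon.

(** * Embedding into the graph product *)

Section EvenWordGroup.
Context (R : realType) (V : finType) (e : V -> R * R * R).
Hypothesis e_norm : forall i, lorentz (e i) (e i) = -1.

Definition even_letters (w : seq V) : bool := [forall i, ~~ odd (count_mem i w)].

Definition even_word : choiceType := {w : seq V | even_letters w}.

Lemma even_wordP (w : even_word) i : ~~ odd (count_mem i (val w)).
Proof. by have /forallP := valP w. Qed.

(** Words are compared by their action, so that the group acts faithfully by construction;
    [act_eq_cox] recovers the Coxeter relations. *)
Definition even_eq (w1 w2 : even_word) : Prop :=
  word_act e (val w1) =1 word_act e (val w2).

Lemma even_cat_subproof (w1 w2 : even_word) :
  even_letters (val w1 ++ val w2).
Proof.
apply/forallP => i; rewrite count_cat oddD.
by rewrite (negbTE (even_wordP w1 i)) (negbTE (even_wordP w2 i)).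
Qed.
Definition even_cat w1 w2 : even_word :=
  Sub (val w1 ++ val w2) (even_cat_subproof w1 w2).

Lemma even_nil_subproof : even_letters [::].
Proof. exact/forallP. Qed.
Definition even_nil : even_word := Sub [::] even_nil_subproof.

Lemma even_rev_subproof (w : even_word) :
  even_letters (rev (val w)).
Proof. by apply/forallP => i; rewrite count_rev even_wordP. Qed.
Definition even_rev w : even_word := Sub (rev (val w)) (even_rev_subproof w).

Lemma even_eq_refl w : even_eq w w.
Proof. by []. Qed.

Lemma even_eq_sym w1 w2 : even_eq w1 w2 -> even_eq w2 w1.
Proof. exact: fsym. Qed.

Lemma even_eq_trans w2 w1 w3 : even_eq w1 w2 -> even_eq w2 w3 -> even_eq w1 w3.
Proof. exact: ftrans. Qed.

Lemma even_eq_cat w1 w1' w2 w2' :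
  even_eq w1 w1' -> even_eq w2 w2' -> even_eq (even_cat w1 w2) (even_cat w1' w2').
Proof. by move=> h1 h2 p; rewrite /= !word_act_cat h2 h1. Qed.

Lemma even_eq_catA w1 w2 w3 :
  even_eq (even_cat w1 (even_cat w2 w3)) (even_cat (even_cat w1 w2) w3).
Proof. by move=> p; rewrite /= catA. Qed.

Lemma even_eq_cat0 w : even_eq (even_cat w even_nil) w.
Proof. by move=> p; rewrite /= cats0. Qed.

Lemma even_eq_revl w : even_eq (even_cat (even_rev w) w) even_nil.
Proof. by move=> p; rewrite /= word_act_cat word_act_rev. Qed.

Lemma even_eq_revr w : even_eq (even_cat w (even_rev w)) even_nil.
Proof. by move=> p; rewrite /= word_act_cat word_act_revK. Qed.

Definition even_pregroup : pregroup :=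
  Pregroup even_eq_refl even_eq_sym even_eq_trans even_eq_cat even_eq_catA
    (even_eq_refl : forall w, even_eq (even_cat even_nil w) w)
    even_eq_cat0 even_eq_revl even_eq_revr.

Definition even_group : groupType := pg_group even_pregroup.

Definition even_group_word (a : even_group) : seq V :=
  val (pg_repr a : even_word).

Lemma even_group_word_even a i : ~~ odd (count_mem i (even_group_word a)).
Proof. exact: even_wordP. Qed.

Lemma even_group_word1 : word_act e (even_group_word 1%g) =1 id.
Proof. exact: (@pg_repr_class even_pregroup even_nil). Qed.

Lemma even_group_wordM a b : word_act e (even_group_word (a * b)%g) =1
  word_act e (even_group_word a) \o word_act e (even_group_word b).
Proof.
move=> p; rewrite /= -word_act_cat.
exact: (@pg_repr_class even_pregroup (even_cat (pg_repr a) (pg_repr b))).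
Qed.

Lemma even_group_word_inj a b :
  word_act e (even_group_word a) =1 word_act e (even_group_word b) -> a = b.
Proof.
by move=> ab; rewrite -(pg_reprK a) -(pg_reprK b); apply/pg_classP.
Qed.

End EvenWordGroup.

(** * The embedding by alternating syllables, and the action that undoes it *)

Section GraphProductEmbedding.
Context (R : realType) (V : finType) (E : rel V) (e : V -> R * R * R).
Hypothesis e_norm : forall i, lorentz (e i) (e i) = -1.
Hypothesis e_orth : forall i j, E i j -> lorentz (e i) (e j) = 0.
Hypothesis E_irr : irreflexive E.
Hypothesis act_faithful : forall w, word_act e w =1 id -> cox_eq E w [::].
Context (G : V -> groupType) (g : forall v, G v).
Hypothesis g_neq1 : forall v, g v != 1%g.
Local Notation GP := (graph_product E G).
Local Notation state := ((forall v, G v) * (R * R * R))%type.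

Definition gp_class (w : word G) : GP :=
  @pg_class (normal_quotient_pregroup (edge_commutators E G))
    (@pg_class (free_product_pregroup G) w).

Lemma gp_class_cat w1 w2 : gp_class (w1 ++ w2) = (gp_class w1 * gp_class w2)%g.
Proof.
have h1 := @pg_classM (free_product_pregroup G) w1 w2.
have h2 := @pg_classM (normal_quotient_pregroup (edge_commutators E G))
  (@pg_class (free_product_pregroup G) w1) (@pg_class (free_product_pregroup G) w2).
exact: etrans (congr1 (@pg_class (normal_quotient_pregroup _)) h1) h2.
Qed.

Lemma gp_class_free w1 w2 : free_eq w1 w2 -> gp_class w1 = gp_class w2.
Proof.
move=> h; apply: (congr1 (@pg_class (normal_quotient_pregroup _))).
exact/(@pg_classP (free_product_pregroup G)).
Qed.

Lemma gp_classC u v (a : G u) (b : G v) w : E u v ->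
  gp_class [:: syl a, syl b & w] = gp_class [:: syl b, syl a & w].
Proof.
move=> uv.
rewrite (gp_class_cat [:: syl a; syl b]) (gp_class_cat [:: syl b; syl a]).
congr (_ * _)%g; apply/pg_classP; apply: coset_eq_sym.
rewrite /= /coset_eq; set x := pg_class _; set y := pg_class _.
have xE : x = (free_in b * free_in a)%g.
  exact: (@pg_classM (free_product_pregroup G) [:: syl b] [:: syl a]).
have yE : y = (free_in a * free_in b)%g.
  exact: (@pg_classM (free_product_pregroup G) [:: syl a] [:: syl b]).
have -> : (x^-1 * y = [~ free_in a, free_in b])%g.
  by rewrite xE yE invgM commgEl conjgE !mulgA.
by move=> N [_]; apply; exists u, v, a, b.
Qed.

Definition toggle (w : seq V) (s : V -> bool) : V -> bool :=
  fun i => s i (+) odd (count_mem i w).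

(* The bit [s i] records the parity of the number of letters [i] already read:
   successive occurrences of [i] become [g i], [(g i)^-1], [g i], ... *)
Fixpoint alternate (s : V -> bool) (w : seq V) : word G :=
  if w is i :: w' then
    syl (if s i then (g i)^-1 else g i)%g :: alternate (toggle [:: i] s) w'
  else [::].

Lemma toggle_cons i w s : toggle w (toggle [:: i] s) = toggle (i :: w) s.
Proof. by apply/funext => j; rewrite /toggle /= addn0 oddD addbA. Qed.

Lemma alternate_cat s w1 w2 :
  alternate s (w1 ++ w2) = alternate s w1 ++ alternate (toggle w1 s) w2.
Proof.
elim: w1 s => [|i w1 IH] s /=; last by rewrite IH toggle_cons.
by congr alternate; apply/funext => i; rewrite /toggle addbF.
Qed.

Lemma toggleC i j s :
  toggle [:: i] (toggle [:: j] s) = toggle [:: j] (toggle [:: i] s).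
Proof. by apply/funext => k; rewrite /toggle addbAC. Qed.

Lemma toggleK i : involutive (toggle [:: i]).
Proof. by move=> s; apply/funext => k; rewrite /toggle addbK. Qed.

(** A cancelled pair [i, i] is read with opposite bits and gives [g i] and its inverse. A swapped
    pair has distinct letters, so neither changes the bit of the other, and the syllables commute in
    the graph product. *)
Lemma alternate_cox w1 w2 s : cox_eq E w1 w2 ->
  gp_class (alternate s w1) = gp_class (alternate s w2).
Proof.
move=> h; elim: h s => {w1 w2}
  [//|w1 w2 _ IH s|w2 w1 w3 _ IH1 _ IH2 s|w1 w2 i s|w1 w2 i j ij s].
- by rewrite IH.
- by rewrite IH1.
- rewrite !alternate_cat !gp_class_cat /=; congr (_ * _)%g.
  move: (toggle w1 s) => t; rewrite toggleK.
  have -> : toggle [:: i] t i = ~~ t i by rewrite /toggle /= eqxx addbT.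
  apply: gp_class_free; apply: free_trans (free_syllable [::] _ _ _) _.
  by case: (t i); rewrite /= ?mulVg ?mulgV; exact: (free_unit [::]).
- rewrite !alternate_cat !gp_class_cat /=; congr (_ * _)%g.
  move: (toggle w1 s) => t; rewrite toggleC.
  have ne : i != j by apply: contraL ij => /eqP->; rewrite E_irr.
  have -> : toggle [:: i] t j = t j by rewrite /toggle /= (negbTE ne) addbF.
  have -> : toggle [:: j] t i = t i by rewrite /toggle /= eq_sym (negbTE ne) addbF.
  exact: gp_classC.
Qed.

Definition gp_step (x : syllable G) (q : state) : state :=
  let v := tag x in let h := (q.1 v * tagged x)%g in
  (dfwith q.1 v h,
   if (q.1 v == g v) != (h == g v) then lreflect (e v) q.2 else q.2).

Definition gp_run (w : word G) (q : state) : state :=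
  foldl (fun q x => gp_step x q) q w.

Lemma gp_run_cat w1 w2 q : gp_run (w1 ++ w2) q = gp_run w2 (gp_run w1 q).
Proof. by rewrite /gp_run foldl_cat. Qed.

(** A step reflects when membership of the coordinate in [{g v}] changes. Along [f v], [f v * a],
    [f v * a * b] these changes add modulo 2, and the reflection is an involution. *)
Lemma gp_run_free w1 w2 : free_eq w1 w2 -> gp_run w1 =1 gp_run w2.
Proof.
elim=> {w1 w2} [//|w1 w2 _ IH q|w2 w1 w3 _ IH1 _ IH2 q|w1 w2 v q|w1 w2 v a b q].
- by rewrite IH.
- by rewrite IH1.
- rewrite !gp_run_cat /=; congr gp_run; case: (gp_run w1 q) => f p.
  rewrite /gp_step /= mulg1 eqxx; congr (_, _).
  by apply/functional_extensionality_dep => u; case: dfwithP.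
- rewrite !gp_run_cat /=; congr gp_run; case: (gp_run w1 q) => f p.
  rewrite /gp_step /= !dfwithin !mulgA; congr (_, _).
    apply/functional_extensionality_dep => u; case: dfwithP => [|u' vu].
      by rewrite dfwithin.
    by rewrite !dfwithout.
  by case: (f v == g v); case: (_ == g v); case: (_ == g v); rewrite //= lreflectK.
Qed.

Lemma gp_step_comm u v (a : G u) (b : G v) q : E u v ->
  gp_step (syl a) (gp_step (syl b) q) = gp_step (syl b) (gp_step (syl a) q).
Proof.
move=> uv; have ne : u != v by apply: contraL uv => /eqP->; rewrite E_irr.
have ne' : v != u by rewrite eq_sym.
case: q => f p; rewrite /gp_step /= !dfwithout//; congr (_, _).
  apply/functional_extensionality_dep => w.
  have [<-{w}|uw] := eqVneq u w; first by rewrite dfwithin dfwithout// dfwithin.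
  have [<-{w uw}|vw] := eqVneq v w; first by rewrite dfwithin dfwithout// dfwithin.
  by rewrite !dfwithout.
by do 2!case: ifP => // _; rewrite lreflectC// e_orth.
Qed.

Let frun (x : free_product G) : state -> state := gp_run (pg_repr x).

Let frun_class (w : word G) :
  frun (@pg_class (free_product_pregroup G) w) =1 gp_run w.
Proof.
by move=> q; apply: gp_run_free; exact: (@pg_repr_class (free_product_pregroup G)).
Qed.

Let frunM x y : frun (x * y)%g =1 frun y \o frun x.
Proof.
move=> q; rewrite /= /frun -gp_run_cat; apply: gp_run_free.
exact: (@pg_repr_class (free_product_pregroup G) (pg_repr x ++ pg_repr y)).
Qed.

Let frun1 : frun 1%g =1 id.
Proof. exact: frun_class [::]. Qed.

Let frunVK x : cancel (frun (x^-1)%g) (frun x).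
Proof. by move=> q; have := frunM (x^-1)%g x q; rewrite mulVg frun1. Qed.

Lemma frun_kernel_normal : normal_subgroup [set x | frun x =1 id].
Proof.
split=> /= [|x y kx ky q|x kx q|x y kx q].
- exact: frun1.
- by rewrite frunM /= kx ky.
- by rewrite -[LHS]kx frunVK.
- by rewrite conjgE frunM /= frunM /= kx frunVK.
Qed.

(** The elements of the free product that act trivially form a normal subgroup containing the edge
    commutators, hence their normal closure. *)
Lemma gp_class_run w1 w2 : gp_class w1 = gp_class w2 -> gp_run w1 =1 gp_run w2.
Proof.
move=> /pg_classP /=.
pose x1 := @pg_class (free_product_pregroup G) w1.
pose x2 := @pg_class (free_product_pregroup G) w2.
rewrite /coset_eq -/x1 -/x2 => N12 q.
have /= ker12 : [set x | frun x =1 id] (x1^-1 * x2)%g.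
  apply: N12; split; first exact: frun_kernel_normal.
  move=> _ [u [v [a [b [uv ->]]]]] {}q /=.
  have fab : frun (free_in a * free_in b)%g =1 frun (free_in b * free_in a)%g.
    by move=> q'; rewrite !frunM /= !frun_class; exact/esym/gp_step_comm.
  have -> : ([~ free_in a, free_in b] =
      (free_in b * free_in a)^-1 * (free_in a * free_in b))%g.
    by rewrite commgEl conjgE invgM !mulgA.
  by rewrite frunM /= fab frunVK.
have := ker12 (frun x1 q); rewrite frunM /=.
have := frunVK (x1^-1)%g q; rewrite invgK => -> .
by rewrite !frun_class.
Qed.

Definition alternating_state (s : V -> bool) : forall v, G v :=
  fun v => if s v then g v else 1%g.

(** Each letter [i] moves coordinate [i] between [1] and [g i], so it always reflects. The run
    applies the first letter first, whence [rev w]. *)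
Lemma gp_run_alternate s w p :
  gp_run (alternate s w) (alternating_state s, p) =
  (alternating_state (toggle w s), word_act e (rev w) p).
Proof.
elim: w s p => [|i w IH] s p /=.
  by congr (alternating_state _, _); apply/funext => i; rewrite /toggle addbF.
have -> : gp_step (syl (if s i then (g i)^-1 else g i)%g) (alternating_state s, p)
    = (alternating_state (toggle [:: i] s), lreflect (e i) p).
  rewrite /gp_step /=; congr (_, _).
    apply/functional_extensionality_dep => j; case: dfwithP => [|j' ij].
      rewrite /alternating_state /toggle /= eqxx addbT.
      by case: (s i); rewrite /= ?mulgV ?mul1g.
    by rewrite /alternating_state /toggle /= (negbTE ij) addbF.
  have g1 : (1%g == g i) = false by rewrite eq_sym (negbTE (g_neq1 i)).
  rewrite /alternating_state.
  by case: (s i); rewrite ?mulgV ?mul1g eqxx g1.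
by rewrite IH toggle_cons rev_cons -cats1 word_act_cat.
Qed.

Lemma act_eq_cox w1 w2 : word_act e w1 =1 word_act e w2 -> cox_eq E w1 w2.
Proof.
move=> h; apply: (@cox_trans _ _ (w1 ++ rev w2 ++ w2)).
  rewrite -{1}(cats0 w1); apply: cox_cat; first exact: cox_refl.
  exact: cox_sym (cox_rev_cat _ _).
rewrite catA -[X in cox_eq _ _ X]cat0s; apply: cox_cat; last exact: cox_refl.
by apply: act_faithful => p; rewrite word_act_cat h word_act_revK.
Qed.

Lemma even_group_embeds : group_embeds (even_group e_norm) GP.
Proof.
exists (fun a => gp_class (alternate (fun=> false) (even_group_word a))).
  (* Evenness resets every bit after the word of [a], so the word of [b] is read from the initial
     bits; this makes the map multiplicative. *)
  move=> a b; have even0 : toggle (even_group_word a) (fun=> false) = (fun=> false).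
    by apply/funext => i; rewrite /toggle /= (negbTE (even_group_word_even a i)).
  rewrite -gp_class_cat.
  have := alternate_cat (fun=> false) (even_group_word a) (even_group_word b).
  rewrite even0 => <-; apply: alternate_cox; apply: act_eq_cox => p.
  by rewrite even_group_wordM word_act_cat.
move=> a b /gp_class_run ab; apply: even_group_word_inj => p.
apply: (can_inj (word_act_revK e_norm (even_group_word b))).
rewrite word_act_rev//.
(* The runs yield the reversed words, that is the inverse actions; from this starting point the run
   of [a] returns to [p]. *)
have := ab (alternating_state (fun=> false), word_act e (even_group_word a) p).
by rewrite !gp_run_alternate => -[_]; rewrite word_act_rev.
Qed.

End GraphProductEmbedding.

(** * Orbit spaces of isometric actions *)

Lemma continuous_mdistP (R : realType) (T : topologicalType) (M : metricType R)
    (f : T -> M) :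
  continuous f <-> forall t r, 0 < r -> \forall s \near t, mdist (f t) (f s) < r.
Proof.
split=> [cf t r r0|h t].
  exact: (metricType_numDomainType.cvgr_dist_lt (cf t)).
by apply/metricType_numDomainType.cvgrPdist_lt => r r0; exact: h.
Qed.

Lemma continuous_mdist (R : realType) (T : topologicalType) (M : metricType R)
    (f g : T -> M) :
  continuous f -> continuous g -> continuous (fun t => mdist (f t) (g t)).
Proof.
move=> /continuous_mdistP cf /continuous_mdistP cg t.
apply/cvgrPdist_lt => r r0; have r2 : 0 < r / 2 by rewrite divr_gt0.
near=> s.
have fs : mdist (f t) (f s) < r / 2 by near: s; exact: cf.
have gs : mdist (g t) (g s) < r / 2 by near: s; exact: cg.
have h1 := metric_triangle (f t) (f s) (g t).
have h2 := metric_triangle (f s) (g s) (g t).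
have h3 := metric_triangle (f s) (f t) (g s).
have h4 := metric_triangle (f t) (g t) (g s).
rewrite (metric_sym (g s)) in h2; rewrite (metric_sym (f s) (f t)) in h3.
by rewrite ltr_norml; apply/andP; split; lra.
Unshelve. all: by end_near. Qed.

(** The uniform gap makes the action free and the projection to the orbits injective on balls of a
    fixed radius. *)
Record isometric_action (R : realType) := IsometricAction {
  ia_space : metricType R;
  ia_group : groupType;
  ia_act : ia_group -> ia_space -> ia_space;
  ia_gap : R;
  ia_act1 : forall x, ia_act 1%g x = x;
  ia_actM : forall a b x, ia_act (a * b)%g x = ia_act a (ia_act b x);
  ia_isom : forall a x y, mdist (ia_act a x) (ia_act a y) = mdist x y;
  ia_gap_gt0 : 0 < ia_gap;
  ia_gapP : forall a x, a != 1%g -> ia_gap <= mdist x (ia_act a x) }.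

Section OrbitSpace.
Context (R : realType) (A : isometric_action R).
Local Notation Y := (ia_space A).
Local Notation G := (ia_group A).
Local Notation act := (@ia_act R A).
Local Notation gap := (ia_gap A).

Definition orbit_rel (x y : Y) : bool := `[< exists a : G, y = act a x >].

Lemma ia_actK (a : G) : cancel (act a) (act (a^-1)%g).
Proof. by move=> x; rewrite -ia_actM mulVg ia_act1. Qed.

Lemma ia_actVK (a : G) : cancel (act (a^-1)%g) (act a).
Proof. by move=> x; rewrite -ia_actM mulgV ia_act1. Qed.

Lemma orbit_rel_refl : reflexive orbit_rel.
Proof. by move=> x; apply/asboolP; exists 1%g; rewrite ia_act1. Qed.

Lemma orbit_rel_sym : symmetric orbit_rel.
Proof.
by move=> x y; apply/asboolP/asboolP => -[a ->]; exists (a^-1)%g; rewrite ia_actK.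
Qed.

Lemma orbit_rel_trans : transitive orbit_rel.
Proof.
move=> y x z /asboolP[a ->] /asboolP[b ->]; apply/asboolP.
by exists (b * a)%g; rewrite ia_actM.
Qed.

Canonical orbit_equiv :=
  EquivRel orbit_rel orbit_rel_refl orbit_rel_sym orbit_rel_trans.

Definition orbit_space : Type := {eq_quot orbit_equiv}.
HB.instance Definition _ := Choice.on orbit_space.

Definition orbit_of (x : Y) : orbit_space := \pi_({eq_quot orbit_equiv}) x.

Definition orbit_repr (x : orbit_space) : Y := repr (x : {eq_quot orbit_equiv}).

Lemma orbit_reprK : cancel orbit_repr orbit_of.
Proof. exact: reprK. Qed.

Lemma orbit_ofP x y : orbit_of x = orbit_of y <-> exists a, y = act a x.
Proof. by split=> [/eqmodP/asboolP//|xy]; apply/eqmodP/asboolP. Qed.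

Lemma orbit_of_act a x : orbit_of (act a x) = orbit_of x.
Proof. by apply/esym/orbit_ofP; exists a. Qed.

(** Translating one of the two representatives suffices because the action is isometric. *)
Definition orbit_dist (x y : orbit_space) : R :=
  inf [set mdist (orbit_repr x) (act a (orbit_repr y)) | a in [set: G]].

Lemma orbit_dist_le x y : orbit_dist (orbit_of x) (orbit_of y) <= mdist x y.
Proof.
have /orbit_ofP[a xa] := orbit_reprK (orbit_of x).
have /orbit_ofP[b yb] := orbit_reprK (orbit_of y).
apply: ge_inf; first by exists 0 => _ [c _ <-]; exact: mdist_ge0.
exists (a^-1 * b)%g => //.
by rewrite -[LHS](ia_isom a) ia_actM ia_actVK -xa -yb.
Qed.

Lemma orbit_dist_lt x y r : orbit_dist (orbit_of x) (orbit_of y) < r ->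
  exists a, mdist x (act a y) < r.
Proof.
have /orbit_ofP[a xa] := orbit_reprK (orbit_of x).
have /orbit_ofP[b yb] := orbit_reprK (orbit_of y).
move=> /inf_lt[|_ [c _ <-] lt]; first by eexists; exists 1%g.
exists (a * c * b^-1)%g; move: xa yb lt.
move: (orbit_repr _) (orbit_repr _) => x' y' -> ->.
by rewrite -ia_actM mulgVK ia_actM ia_isom.
Qed.

(** Otherwise [b * a^-1] would move [act a y] by less than the gap. *)
Lemma ia_gap_eq (a b : G) x y :
  mdist x (act a y) < gap / 2 -> mdist x (act b y) < gap / 2 -> a = b.
Proof.
move=> xa xb; apply/eqP; rewrite -[a == b]negbK; apply/negP => ab.
have : gap <= mdist (act a y) (act ((b * a^-1))%g (act a y)).
  by apply: ia_gapP; apply: contra ab; rewrite mulg_eq1 invgK eq_sym.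
rewrite ia_actM ia_actK; have := metric_triangle (act a y) x (act b y).
by rewrite (metric_sym (act a y) x); lra.
Qed.

Lemma orbit_dist_isom x y : mdist x y < gap / 2 ->
  orbit_dist (orbit_of x) (orbit_of y) = mdist x y.
Proof.
move=> xy; apply/eqP; rewrite eq_le orbit_dist_le leNgt /=; apply/negP.
move=> /orbit_dist_lt[a xa].
have a1 : a = 1%g.
  by apply: (@ia_gap_eq _ _ x y); [exact: lt_trans xy|rewrite ia_act1].
by move: xa; rewrite a1 ia_act1 ltxx.
Qed.

Lemma orbit_distxx x : orbit_dist x x = 0.
Proof.
have gap2 : 0 < gap / 2 by rewrite divr_gt0// ia_gap_gt0.
by rewrite -(orbit_reprK x) orbit_dist_isom ?mdistxx.
Qed.

Lemma orbit_dist_positivity x y : orbit_dist x y = 0 -> x = y.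
Proof.
rewrite -(orbit_reprK x) -(orbit_reprK y).
move: (orbit_repr x) (orbit_repr y) => {}x {}y xy.
have gap2 : 0 < gap / 2 by rewrite divr_gt0// ia_gap_gt0.
have [a xa] : exists a, mdist x (act a y) < gap / 2.
  by apply: orbit_dist_lt; rewrite xy.
have := orbit_dist_isom xa; rewrite orbit_of_act xy => /esym/mdist_positivity ->.
by rewrite orbit_of_act.
Qed.

Lemma orbit_dist_sym_le x y : orbit_dist x y <= orbit_dist y x.
Proof.
rewrite -(orbit_reprK x) -(orbit_reprK y).
move: (orbit_repr x) (orbit_repr y) => {}x {}y.
rewrite leNgt; apply/negP => /orbit_dist_lt[a].
rewrite metric_sym => /(le_lt_trans (orbit_dist_le _ _)).
by rewrite orbit_of_act ltxx.
Qed.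

Lemma orbit_dist_sym x y : orbit_dist x y = orbit_dist y x.
Proof. by apply/eqP; rewrite eq_le !orbit_dist_sym_le. Qed.

Lemma orbit_dist_triangle y x z :
  orbit_dist x z <= orbit_dist x y + orbit_dist y z.
Proof.
rewrite -(orbit_reprK x) -(orbit_reprK y) -(orbit_reprK z).
move: (orbit_repr x) (orbit_repr y) (orbit_repr z) => {}x {}y {}z.
apply/ler_addgt0Pl => r r0; have r2 : 0 < r / 2 by rewrite divr_gt0.
have [a xa] : exists a,
    mdist x (act a y) < orbit_dist (orbit_of x) (orbit_of y) + r / 2.
  by apply: orbit_dist_lt; rewrite ltrDl.
have [b yb] : exists b,
    mdist y (act b z) < orbit_dist (orbit_of y) (orbit_of z) + r / 2.
  by apply: orbit_dist_lt; rewrite ltrDl.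
have := orbit_dist_le x (act (a * b)%g z); rewrite orbit_of_act ia_actM.
have := metric_triangle x (act a y) (act a (act b z)); rewrite ia_isom.
lra.
Qed.

HB.instance Definition _ := isMetric.Build R orbit_space
  orbit_distxx orbit_dist_positivity orbit_dist_sym orbit_dist_triangle.

Lemma orbit_of_isom x y : mdist x y < gap / 2 ->
  mdist (orbit_of x : orbit_space) (orbit_of y) = mdist x y.
Proof. exact: orbit_dist_isom. Qed.

Lemma orbit_of_le x y : mdist (orbit_of x : orbit_space) (orbit_of y) <= mdist x y.
Proof. exact: orbit_dist_le. Qed.

Lemma orbit_of_cts : continuous (orbit_of : Y -> orbit_space).
Proof.
apply/continuous_mdistP => x r r0; near=> y.
apply: le_lt_trans (orbit_of_le _ _) _; near: y.
by apply: (iffLR (continuous_mdistP (@id Y)) _ x r r0) => t; exact: cvg_id.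
Unshelve. all: by end_near. Qed.

(** Two points within a quarter of the gap from a third are less than half the gap apart, where the
    projection is isometric. *)
Definition lift_radius : R := gap / 4.
Local Notation rho := lift_radius.

Lemma lift_radius_gt0 : 0 < rho.
Proof. by rewrite divr_gt0// ia_gap_gt0. Qed.

Lemma lift_exists x (z : orbit_space) r : mdist (orbit_of x) z < r ->
  exists2 y, orbit_of y = z & mdist x y < r.
Proof.
rewrite -{1}(orbit_reprK z) => /orbit_dist_lt[a].
exists (act a (orbit_repr z)) => //.
by rewrite orbit_of_act orbit_reprK.
Qed.

(** The local inverse of the projection around [x]; the default [x] is taken only when [z] is too
    far away to have a lift in the ball. *)
Definition lift_near x (z : orbit_space) : Y :=
  xget x [set y | orbit_of y = z /\ mdist x y < rho].

Lemma lift_nearP x z : mdist (orbit_of x) z < rho ->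
  orbit_of (lift_near x z) = z /\ mdist x (lift_near x z) < rho.
Proof.
by move=> /lift_exists[y yz xy]; rewrite /lift_near; case: xgetP => [//|/(_ y)[]].
Qed.

Lemma lift_near_isom x z z' :
  mdist (orbit_of x) z < rho -> mdist (orbit_of x) z' < rho ->
  mdist (lift_near x z) (lift_near x z') = mdist z z'.
Proof.
move=> /lift_nearP[zE xz] /lift_nearP[z'E xz'].
rewrite -{2}zE -{2}z'E orbit_of_isom//.
have := metric_triangle (lift_near x z) x (lift_near x z').
by rewrite (metric_sym (lift_near x z) x); move: xz xz'; rewrite /lift_radius; lra.
Qed.

Lemma lift_near_uniq x y : mdist x y < rho -> lift_near x (orbit_of y) = y.
Proof.
move=> xy.
have /lift_nearP[yE xy'] : mdist (orbit_of x : orbit_space) (orbit_of y) < rho.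
  exact: le_lt_trans (orbit_of_le _ _) xy.
apply/esym/mdist_positivity; rewrite -orbit_of_isom ?yE ?mdistxx//.
have := metric_triangle y x (lift_near x (orbit_of y)).
by rewrite (metric_sym y x); move: xy xy'; rewrite /lift_radius; lra.
Qed.

End OrbitSpace.

(** * Lifting paths and homotopies *)

(** Heine-Cantor on [[0, 1]], with [s] free to leave the interval. *)
Lemma uniform_mdist (R : realType) (M : metricType R) (f : R -> M) r :
  continuous f -> 0 < r -> exists2 d, 0 < d &
    forall t s, 0 <= t <= 1 -> `|t - s| < d -> mdist (f t) (f s) < r.
Proof.
move=> /continuous_mdistP cf r0; have r2 : 0 < r / 2 by rewrite divr_gt0.
have cov := (compact_near_coveringP _).1 (@segment_compact R 0 1).
have := cov R (0^'+) (fun d t => forall s, `|t - s| < d -> mdist (f t) (f s) < r) _.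
case=> [t _|/= d d0 H].
  have /nbhs_ballP[e /= e0 He] := cf t _ r2.
  have e2 : 0 < e / 2 by rewrite divr_gt0.
  near=> t' d => /= s t's.
  have tt' : `|t - t'| < e / 2.
    by near: t'; exact: (nbhsx_ballx t _ e2).
  have de : d < e / 2 by near: d; exact: nbhs_right_lt.
  have h1 : mdist (f t) (f t') < r / 2 by apply: He; rewrite -ball_normE /=; lra.
  have h2 : mdist (f t) (f s) < r / 2.
    apply: He; rewrite -ball_normE /=; have := ler_normD (t - t') (t' - s).
    by rewrite addrA subrK; lra.
  have := metric_triangle (f t') (f t) (f s).
  by rewrite (metric_sym (f t') (f t)); lra.
exists (d / 2); first by rewrite divr_gt0.
move=> t s t01 ts; apply: (H (d / 2)) => //=.
- by rewrite sub0r normrN gtr0_norm ?divr_gt0//; move: d0 => /=; lra.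
- by rewrite divr_gt0.
Unshelve. all: by end_near. Qed.

Section Lifting.
Context (R : realType) (A : isometric_action R).
Local Notation Y := (ia_space A).
Local Notation X := (orbit_space A).
Local Notation proj := (@orbit_of R A).
Local Notation rho := (lift_radius A).

(* The distance between the two lifts varies continuously and cannot take the
   value [rho], which is less than half the gap. *)
Lemma lift_close (g g' : R -> Y) : continuous g -> continuous g' ->
  g 0 = g' 0 ->
  (forall t, 0 <= t <= 1 -> mdist (proj (g t) : X) (proj (g' t)) < rho) ->
  mdist (g 1) (g' 1) < rho.
Proof.
move=> cg cg' g0 close; pose D t := mdist (g t) (g' t).
have cD : continuous D by exact: continuous_mdist.
have r0 := lift_radius_gt0 A.
have small t : 0 <= t <= 1 -> D t < ia_gap A / 2 -> D t < rho.
  by move=> t01 Dt; have := close t t01; rewrite orbit_of_isom.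
rewrite -/(D 1) ltNge; apply/negP => D1.
have [|||s] := @IVT R D 0 1 rho.
- exact: ler01.
- exact: continuous_subspaceT.
- have D0 : D 0 = 0 by rewrite /D g0 mdistxx.
  by rewrite D0 ge_min le_max (ltW r0) D1 orbT.
rewrite in_itv /= => s01 Ds; have := small s s01.
rewrite Ds ltxx => h; have : false by apply: h; move: r0; rewrite /lift_radius; lra.
by [].
Qed.

Lemma lift_end (g g' : R -> Y) : continuous g -> continuous g' ->
  g 0 = g' 0 ->
  (forall t, 0 <= t <= 1 -> mdist (proj (g t) : X) (proj (g' t)) < rho) ->
  proj (g 1) = proj (g' 1) -> g 1 = g' 1.
Proof.
move=> cg cg' g0 close g1; have := lift_close cg cg' g0 close => lt.
apply: mdist_positivity; rewrite -orbit_of_isom ?g1 ?mdistxx//.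
by have := lift_radius_gt0 A; move: lt; rewrite /lift_radius; lra.
Qed.

Lemma lift_near_cts x (f : R -> X) : continuous f ->
  (forall t, mdist (proj x : X) (f t) < rho) ->
  continuous (fun t => lift_near x (f t)).
Proof.
move=> /continuous_mdistP cf fx; apply/continuous_mdistP => t r r0; near=> s.
by rewrite lift_near_isom//; near: s; exact: cf.
Unshelve. all: by end_near. Qed.

(** [f] moves by less than the lifting radius over an interval of length [h], so a lift up to
    [k * h] is prolonged to [k.+1 * h] by the local inverse around its last point. *)
Lemma path_lift (f : R -> X) y0 : continuous f -> proj y0 = f 0 ->
  exists g : R -> Y, [/\ continuous g, g 0 = y0 &
    forall t, 0 <= t <= 1 -> proj (g t) = f t].
Proof.
move=> cf y0f; have [d d0 Hd] := uniform_mdist cf (lift_radius_gt0 A).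
pose h := d / 2; have h0 : 0 < h by rewrite divr_gt0.
have step (k : nat) : exists g : R -> Y, [/\ continuous g, g 0 = y0 &
    forall t, 0 <= t <= 1 -> t <= k%:R * h -> proj (g t) = f t].
  elim: k => [|k [g [cg g0 gf]]].
    exists (fun=> y0); split=> //; first exact: cst_continuous.
    move=> t /andP[t0 _]; rewrite mul0r => t0'.
    by have -> : t = 0 by apply/eqP; rewrite eq_le t0'.
  pose a := k%:R * h; have a0 : 0 <= a by rewrite mulr_ge0// ltW.
  have [a1|a1] := leP a 1; last first.
    by exists g; split=> // t t01 _; apply: gf => //; move: t01; rewrite -/a; lra.
  (* Clamping the time to [[a, a + h]] keeps [f (c t)] in the ball for every real [t], so that the
     local lift is continuous everywhere. *)
  pose c (t : R) := Num.min (Num.max a t) (a + h).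
  have cc : continuous c.
    move=> t; apply: (@continuous_min _ _ (fun t => Num.max a t) (cst (a + h))).
      by apply: (@continuous_max _ _ (cst a) id); [exact: cvg_cst|exact: cvg_id].
    exact: cvg_cst.
  have ca t : `|a - c t| < d.
    rewrite distrC ger0_norm; last first.
      by rewrite subr_ge0 le_min le_max lexx /= lerDl ltW.
    have : c t <= a + h by rewrite ge_min lexx orbT.
    by rewrite /h; move: d0; lra.
  have ga : proj (g a) = f a by apply: gf; rewrite ?a0.
  have close t : mdist (proj (g a) : X) (f (c t)) < rho.
    by rewrite ga; apply: Hd; rewrite ?a0.
  exists (fun t => if t <= a then g t else lift_near (g a) (f (c t))); split.
  - apply: (@paste_cts R R Y id); [by move=> t; exact: cvg_id|exact: cg| |].
      apply: lift_near_cts close => t; apply: (@continuous_comp _ _ _ c f).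
        exact: cc.
      exact: cf.
    move=> t ->; have -> : c a = a by rewrite /c maxxx (min_idPl _)// lerDl ltW.
    by rewrite -ga lift_near_uniq// mdistxx lift_radius_gt0.
  - by rewrite a0.
  - move=> t t01 tk; case: ifP => [|/negbT]; first exact: gf.
    rewrite -ltNge => at_; have -> : f t = f (c t).
      congr f; rewrite /c (max_idPr (ltW at_)) (min_idPl _)//.
      by move: tk; rewrite -natr1 mulrDl mul1r.
    by case: (lift_nearP (close t)).
have [g [cg g0 gf]] := step (Num.bound h^-1).
exists g; split=> // t t01; apply: gf => //.
have : h^-1 < (Num.bound h^-1)%:R by rewrite archi_boundP// invr_ge0 ltW.
rewrite -(ltr_pM2r h0) mulVf ?gt_eqF//; move: t01; lra.
Qed.

(* The endpoint of the lift of [F (_, s)] is locally constant in [s]. *)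
Lemma homotopy_lift_end (F : R * R -> X) (y0 : Y) (b : X) (g g' : R -> Y) :
  continuous F -> (forall s, F (0, s) = proj y0) -> (forall s, F (1, s) = b) ->
  continuous g -> continuous g' -> g 0 = y0 -> g' 0 = y0 ->
  (forall t, 0 <= t <= 1 -> proj (g t) = F (t, 0)) ->
  (forall t, 0 <= t <= 1 -> proj (g' t) = F (t, 1)) ->
  g 1 = g' 1.
Proof.
move=> cF F0 F1 cg cg' g0 g'0 gF g'F.
have r0 := lift_radius_gt0 A.
have cFs s : continuous (fun t => F (t, s)).
  move=> t; apply: (@continuous_comp _ _ _ (fun t => (t, s)) F); last exact: cF.
  have c1 : continuous (@id R) by move=> u; exact: cvg_id.
  have c2 : continuous (@cst R R s) by exact: cst_continuous.
  exact: (cvg_pair (c1 t) (c2 t)).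
have /choice[L HL] s : exists L : R -> Y, [/\ continuous L, L 0 = y0 &
    forall t, 0 <= t <= 1 -> proj (L t) = F (t, s)].
  by apply: path_lift => //; rewrite F0.
have I1 : (0 : R) <= (1 : R) <= (1 : R) by rewrite ler01 lexx.
have end_eq s (l : R -> Y) : continuous l -> l 0 = y0 ->
    (forall t, 0 <= t <= 1 -> mdist (F (t, s)) (proj (l t)) < rho) ->
    proj (l 1) = b -> L s 1 = l 1.
  move=> cl l0 lF l1; have [cL L0 LF] := HL s.
  by apply: lift_end; rewrite ?L0 ?l0 ?l1 ?LF ?F1// => t t01; rewrite LF// lF.
have <- : L 0 1 = g 1.
  by apply: end_eq; rewrite ?gF ?F1// => t t01; rewrite gF ?mdistxx.
have <- : L 1 1 = g' 1.
  by apply: end_eq; rewrite ?g'F ?F1// => t t01; rewrite g'F ?mdistxx.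
(* Compactness of [[0, 1]] gives one neighborhood of [s] that keeps the paths [F (_, s)] and
   [F (_, s')] close at all times; their lifts then end together. *)
have Lloc s : \forall s' \near s, L s 1 = L s' 1.
  have cov := (compact_near_coveringP _).1 (@segment_compact R 0 1).
  have H : \forall s' \near s, `[0, 1]%classic `<=`
      (fun t => mdist (F (t, s)) (F (t, s')) < rho).
    apply: (cov R (nbhs s) (fun s' t => mdist (F (t, s)) (F (t, s')) < rho)) => t _.
    have [r2 rr] : 0 < rho / 2 /\ rho / 2 + rho / 2 = rho by split; lra.
    have [[U V] /= [tU sV] UV] := (iffLR (continuous_mdistP F) cF (t, s) _ r2).
    near=> t' s'; rewrite -rr.
    have h1 : mdist (F (t, s)) (F (t', s)) < rho / 2.
      apply: (UV (t', s)); split=> /=; last exact: nbhs_singleton.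
      by near: t'.
    have h2 : mdist (F (t, s)) (F (t', s')) < rho / 2.
      by apply: (UV (t', s')); split=> /=; [near: t'|near: s'].
    rewrite metric_sym in h1.
    by have := metric_triangle (F (t', s)) (F (t, s)) (F (t', s')); lra.
  apply: filterS H => s' Hs'.
  have [cL L0 LF] := HL s'; apply: end_eq => //; rewrite ?LF ?F1// => t t01.
  by rewrite LF//; apply: Hs'; rewrite /= in_itv.
(* All the endpoints lie over [b], so [D] cannot take a nonzero value below half the gap; the
   intermediate value theorem then excludes [D 1 != 0]. *)
pose D s := mdist (L 0 1) (L s 1).
have cD : continuous D.
  move=> s; apply: cvg_near_cst; apply: filterS (Lloc s) => s' e.
  by rewrite /D e.
apply: mdist_positivity; apply/eqP; rewrite -[_ == _]negbK; apply/negP => D1.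
have Lb s : proj (L s 1) = b by have [_ _ ->] := HL s.
have dich s : D s < ia_gap A / 2 -> D s = 0.
  by move=> Ds; rewrite /D -orbit_of_isom// !Lb mdistxx.
have D1' : rho <= D 1.
  rewrite leNgt; apply/negP => lt; move/negP: D1; apply; apply/eqP; apply: dich.
  by move: lt r0; rewrite /lift_radius; lra.
have [|||s _ Ds] := @IVT R D 0 1 rho.
- exact: ler01.
- exact: continuous_subspaceT.
- have D0 : D 0 = 0 by rewrite /D mdistxx.
  by rewrite D0 ge_min le_max (ltW r0) D1' orbT.
have := dich s; rewrite Ds => h.
have : rho = 0 by apply: h; move: r0; rewrite /lift_radius; lra.
by move: r0 => /[swap] ->; rewrite ltxx.
Unshelve. all: by end_near. Qed.

End Lifting.

(** * The fundamental group of an orbit space *)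

Section OrbitFundamentalGroup.
Context (R : realType) (A : isometric_action R).
Local Notation Y := (ia_space A).
Local Notation X := (orbit_space A).
Local Notation G := (ia_group A).
Local Notation I := (unit_interval R).
Local Notation proj := (@orbit_of R A).
Local Notation act := (@ia_act R A).
Local Notation "x ~~> y" := {path I from x to y in Y} (at level 70).

Context (Y_path : forall x y : Y, x ~~> y).
Hypothesis Y_simply : forall (x y : Y) (p q : x ~~> y), path_homotopic p q.
Context (y0 : Y).
Local Notation loop := {path I from (proj y0 : X) to (proj y0 : X) in X}.

(** The lifts [p] and [q] share their ends, so they are homotopic in [Y], and the homotopy
    projects. *)
Lemma loops_homotopic (y1 : Y) (p q : y0 ~~> y1) (l1 l2 : loop) :
  l1 =1 proj \o p -> l2 =1 proj \o q -> path_homotopic l1 l2.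
Proof.
move=> l1E l2E; have [H [cH H0 H1 Hx Hy]] := Y_simply p q.
exists (proj \o H); split=> [|t|t|s|s] /=.
- by move=> t; apply: continuous_comp; [exact: cH|exact: orbit_of_cts].
- by rewrite H0 l1E.
- by rewrite H1 l2E.
- by rewrite Hx.
- by rewrite Hy; have := l1E one; rewrite /= !path_one.
Qed.

Lemma act_cts a : continuous (act a : Y -> Y).
Proof.
apply/continuous_mdistP => x r r0; near=> y; rewrite ia_isom; near: y.
by apply: (iffLR (continuous_mdistP (@id Y)) _ x r r0) => t; exact: cvg_id.
Unshelve. all: by end_near. Qed.

Lemma proj_path_cts (y1 y2 : Y) (p : y1 ~~> y2) : continuous (proj \o p : I -> X).
Proof.
by move=> t; apply: continuous_comp; [exact: (@cts_fun _ _ p)|exact: orbit_of_cts].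
Qed.

Definition deck_path (a : G) : y0 ~~> act a y0 :=
  Y_path y0 (act a y0).

Lemma deck_loop_zero a : (proj \o deck_path a) zero = proj y0.
Proof. by rewrite /= path_zero. Qed.

Lemma deck_loop_one a : (proj \o deck_path a) one = proj y0.
Proof. by rewrite /= path_one orbit_of_act. Qed.

Definition deck_loop (a : G) : loop :=
  mk_path (@proj_path_cts _ _ (deck_path a)) (deck_loop_zero a) (deck_loop_one a).

Definition deck_class (a : G) : fundamental_group R (proj y0 : X) :=
  @pg_class (loop_pregroup R (proj y0 : X)) (deck_loop a).

Lemma act_path_cts a (y1 y2 : Y) (p : y1 ~~> y2) : continuous (act a \o p).
Proof.
by move=> t; apply: continuous_comp; [exact: (@cts_fun _ _ p)|exact: act_cts].
Qed.

Lemma act_path_zero a (y1 y2 : Y) (p : y1 ~~> y2) : (act a \o p) zero = act a y1.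
Proof. by rewrite /= path_zero. Qed.

Lemma act_path_one a (y1 y2 : Y) (p : y1 ~~> y2) : (act a \o p) one = act a y2.
Proof. by rewrite /= path_one. Qed.

Definition act_path a (y1 y2 : Y) (p : y1 ~~> y2) : act a y1 ~~> act a y2 :=
  mk_path (@act_path_cts a _ _ p) (act_path_zero a p) (act_path_one a p).

(** The path of [a] followed by the [a]-translate of the path of [b] lifts the product loop and ends
    at the same point as the path of [a * b]. *)
Lemma deck_classM : {morph deck_class : a b / (a * b)%g}.
Proof.
move=> a b; rewrite /deck_class -(@pg_classM (loop_pregroup R (proj y0 : X))).
apply/(@pg_classP (loop_pregroup R (proj y0 : X))).
pose q := path_cat (deck_path a) (act_path a (deck_path b)).
have q0 : q zero = y0 by rewrite path_zero.
have q1 : q one = act (a * b)%g y0 by rewrite path_one ia_actM.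
apply: (@loops_homotopic _ (deck_path (a * b)%g)
  (mk_path (@cts_fun _ _ q) q0 q1)) => // t.
rewrite /= /mk_path /= /path_cat_fun.
by case: ifP => // _; rewrite /= orbit_of_act.
Qed.

(** Homotopic loops have lifts with the same endpoint, so [a] and [b] agree at [y0], and the action
    is free. *)
Lemma deck_class_inj : injective deck_class.
Proof.
move=> a b /(@pg_classP (loop_pregroup R (proj y0 : X))) [H [cH H0 H1 Hx Hy]].
have ccl (y : Y) (p : y0 ~~> y) : continuous (fun t : R => p (clampI t)).
  by apply: (@comp_clamp_cts R R Y id) => [t|]; [exact: cvg_id|exact: cts_fun].
have clamp0 : clampI (0 : R) = zero by rewrite clampI_le0.
have clamp1 : clampI (1 : R) = one by rewrite clampI_ge1.
have cF : continuous (fun z : R * R => H (clampI z.1, clampI z.2)).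
  by apply: comp2_clamp_cts cH => t; [exact: cvg_fst|exact: cvg_snd].
have := homotopy_lift_end (y0 := y0) (b := proj y0) cF _ _ (ccl _ (deck_path a))
  (ccl _ (deck_path b)).
rewrite /= clamp0 clamp1 !path_zero !path_one.
move=> /(_ _ _ erefl erefl) ab.
have {}ab : act a y0 = act b y0.
  by apply: ab => [s|s|t _|t _]; rewrite ?Hx ?Hy ?H0 ?H1.
apply/eqP; rewrite -[_ == _]negbK; apply/negP => ne.
have := @ia_gapP R A (a^-1 * b)%g y0; rewrite ia_actM -ab ia_actK mdistxx.
rewrite mulg_eq1 eqg_inv ne => /(_ isT); have := ia_gap_gt0 A; lra.
Qed.

(** The lift of a loop ends over the base point, at some [act a y0]. *)
Lemma deck_class_surj c : exists a, c = deck_class a.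
Proof.
have [l ->] := pg_class_surj c.
have cl : continuous (fun t : R => (l : loop) (clampI t)).
  by apply: (@comp_clamp_cts R R X id) => [t|]; [exact: cvg_id|exact: cts_fun].
have clamp0 : clampI (0 : R) = zero by rewrite clampI_le0.
have clamp1 : clampI (1 : R) = one by rewrite clampI_ge1.
have [|g [cg g0 gl]] := path_lift (y0 := y0) cl; first by rewrite clamp0 path_zero.
have /orbit_ofP[a ga] : proj y0 = proj (g 1).
  by rewrite gl ?clamp1 ?path_one// ler01 lexx.
exists a; apply/(@pg_classP (loop_pregroup R (proj y0 : X))).
have cq : continuous (g \o @valI R).
  by move=> t; apply: continuous_comp; [exact: valI_cts|exact: cg].
have q0 : (g \o @valI R) zero = y0 by rewrite /= valI0.
have q1 : (g \o @valI R) one = act a y0 by rewrite /= valI1.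
apply: (@loops_homotopic _ (mk_path cq q0 q1) (deck_path a)) => // t.
by rewrite /= /mk_path /= gl ?valIK// valI_itv.
Qed.

Lemma deck_group_iso : group_iso G (fundamental_group R (proj y0 : X)).
Proof.
exists deck_class; first exact: deck_classM.
have /choice[h hE] := deck_class_surj.
by exists h => x; [apply: deck_class_inj; rewrite -hE|rewrite -hE].
Qed.

Lemma orbit_space_connected : connected [set: X].
Proof.
have -> : [set: X] = \bigcup_(y in [set: Y]) ((fun t : R =>
    proj (Y_path y0 y (clampI t)) : X) @` `[0, 1]).
  apply/seteqP; split => // x _; exists (orbit_repr x) => //.
  exists 1; first by rewrite /= in_itv /= ler01 lexx.
  by rewrite clampI_ge1// path_one orbit_reprK.
apply: bigcup_connected => [|y _].
  exists (proj y0) => y _; exists 0; first by rewrite /= in_itv /= ler01 lexx.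
  by rewrite clampI_le0// path_zero.
apply: connected_continuous_connected; first exact: segment_connected.
apply: continuous_subspaceT.
by apply: (@comp_clamp_cts R R X id (proj \o Y_path y0 y)) => [t|];
  [exact: cvg_id|exact: proj_path_cts].
Qed.

End OrbitFundamentalGroup.

Lemma orbit_space_compact (R : realType) (A : isometric_action R)
    (T : topologicalType) (f : T -> ia_space A) (K : set T) :
  compact K -> continuous f -> (forall y, exists a t, K t /\ ia_act a y = f t) ->
  compact [set: orbit_space A].
Proof.
move=> cK cf fK; have -> : [set: orbit_space A] = (@orbit_of R A \o f) @` K.
  apply/seteqP; split => // x _; have [a [t [Kt ft]]] := fK (orbit_repr x).
  by exists t => //=; rewrite -ft orbit_of_act orbit_reprK.
apply: continuous_compact => //; apply: continuous_subspaceT => t.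
by apply: continuous_comp; [exact: cf|exact: orbit_of_cts].
Qed.

Lemma orbit_space_locally_hyperbolic (R : realType) (A : isometric_action R)
    (phi : ia_space A -> R * R) :
  (forall y, upper_half_plane (phi y)) ->
  (forall y z, hyperbolic_dist (phi y) (phi z) = mdist y z) ->
  (forall w, upper_half_plane w -> exists y, phi y = w) ->
  locally_hyperbolic (orbit_space A : metricType R).
Proof.
move=> phiU phid phis x; set y := orbit_repr x.
have yx : orbit_of y = x by exact: orbit_reprK.
have r0 := lift_radius_gt0 A.
have lyx : lift_near y x = y by rewrite -{1}yx lift_near_uniq// mdistxx.
exists (lift_radius A), (phi \o lift_near y); split => //=.
- move=> z z'; rewrite !ballEmdist /= => xz xz'.
  by rewrite phid lift_near_isom// yx.
- rewrite lyx; apply/seteqP; split => [_ [z + <-]|w [wU]].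
    rewrite ballEmdist /= => xz; split; first exact: phiU.
    by rewrite phid; apply: (lift_nearP _).2; rewrite yx.
  have [z zw] := phis w wU; rewrite -zw phid => yz.
  exists (orbit_of z); last by rewrite /= lift_near_uniq.
  by rewrite ballEmdist /= -yx; apply: le_lt_trans yz; exact: orbit_of_le.
Qed.

(** * The hyperbolic plane as a metric space *)

Section Arcosh.
Context (R : realType).
Implicit Types x y r : R.

Definition cosh r : R := (expR r + expR (- r)) / 2.

Let exp_arcosh_gt0 x : 1 <= x -> 0 < x + Num.sqrt (x ^+ 2 - 1).
Proof. by move=> x1; rewrite ltr_wpDr ?sqrtr_ge0// (lt_le_trans ltr01). Qed.

Let sqr_ge1 x : 1 <= x -> 0 <= x ^+ 2 - 1.
Proof. by move=> x1; rewrite subr_ge0 expr2 -{1}(mulr1 1) ler_pM. Qed.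

Lemma arcosh1 : arcosh (1 : R) = 0.
Proof. by rewrite /arcosh expr1n subrr sqrtr0 addr0 ln1. Qed.

Lemma ltr_arcosh x y : 1 <= x -> 1 <= y -> (arcosh x < arcosh y) = (x < y).
Proof.
have mono x' y' : 1 <= x' -> x' < y' -> arcosh x' < arcosh y'.
  move=> x1 xy; have y1 : 1 <= y' by rewrite (le_trans x1)// ltW.
  rewrite ltr_ln ?posrE ?exp_arcosh_gt0// ltr_leD// ler_wsqrtr// lerD2r.
  by rewrite ler_sqr ?nnegrE; lra.
move=> x1 y1; have [xy|yx|->] := ltgtP x y; last by rewrite ltxx.
  exact: mono.
by apply/negbTE; rewrite -leNgt ltW// mono.
Qed.

Lemma ler_arcosh x y : 1 <= x -> 1 <= y -> (arcosh x <= arcosh y) = (x <= y).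
Proof. by move=> x1 y1; rewrite !leNgt ltr_arcosh. Qed.

Lemma arcoshD x y : 1 <= x -> 1 <= y -> arcosh x + arcosh y =
  arcosh (x * y + Num.sqrt (x ^+ 2 - 1) * Num.sqrt (y ^+ 2 - 1)).
Proof.
move=> x1 y1; rewrite -lnM ?posrE ?exp_arcosh_gt0//; congr ln.
have sx := sqr_sqrtr (sqr_ge1 x1); have sy := sqr_sqrtr (sqr_ge1 y1).
have x0 := sqrtr_ge0 (x ^+ 2 - 1); have y0 := sqrtr_ge0 (y ^+ 2 - 1).
move: sx sy x0 y0.
move: (Num.sqrt (x ^+ 2 - 1)) (Num.sqrt (y ^+ 2 - 1)) => a b sx sy a0 b0.
have -> : (x * y + a * b) ^+ 2 - 1 = (x * b + y * a) ^+ 2.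
  transitivity (x ^+ 2 * y ^+ 2 + 2 * (x * y * a * b) + a ^+ 2 * b ^+ 2 - 1).
    ring.
  transitivity (x ^+ 2 * b ^+ 2 + 2 * (x * y * a * b) + y ^+ 2 * a ^+ 2); last ring.
  by rewrite sx sy; ring.
rewrite sqrtr_sqr ger0_norm; first ring.
by rewrite addr_ge0// mulr_ge0//; lra.
Qed.

Lemma cosh_ge1 r : 1 <= cosh r.
Proof.
have e0 := expR_gt0 r; rewrite /cosh expRN ler_pdivlMr// mul1r.
have : 0 <= (expR r - 1) ^+ 2 / expR r by rewrite divr_ge0 ?sqr_ge0// ltW.
have -> : (expR r - 1) ^+ 2 / expR r = expR r + (expR r)^-1 - 2.
  by field; rewrite gt_eqF.
by rewrite subr_ge0.
Qed.

Lemma cosh_arcosh r : 0 <= r -> arcosh (cosh r) = r.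
Proof.
move=> r0; have e0 := expR_gt0 r.
have e1 : 1 <= expR r by rewrite -(expR0 R) ler_expR.
have -> : arcosh (cosh r) = ln (cosh r + (expR r - expR (- r)) / 2).
  rewrite /arcosh; congr (ln (_ + _)).
  have -> : cosh r ^+ 2 - 1 = ((expR r - expR (- r)) / 2) ^+ 2.
    by rewrite /cosh expRN; field; rewrite gt_eqF.
  rewrite sqrtr_sqr ger0_norm// divr_ge0// subr_ge0 expRN.
  by apply: le_trans (e1); rewrite invf_le1.
by rewrite /cosh -[RHS]expRK; congr ln; field.
Qed.

Lemma arcosh_lt x r : 1 <= x -> 0 <= r -> (arcosh x < r) = (x < cosh r).
Proof. by move=> x1 r0; rewrite -{1}(cosh_arcosh r0) ltr_arcosh// cosh_ge1. Qed.

End Arcosh.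

(** * The hyperboloid with its distance *)

Section HyperbolicPlane.
Context (R : realType).
Local Notation vec := (R * R * R)%type.

Definition hyp_plane : Type := {p : vec | hyperboloid p}.
HB.instance Definition _ := Choice.on hyp_plane.

Definition hyp_val (p : hyp_plane) : vec := val p.

Lemma hyp_valP p : hyperboloid (hyp_val p).
Proof. exact: valP. Qed.

Definition hyp_dist (p q : hyp_plane) : R :=
  arcosh (lorentz (hyp_val p) (hyp_val q)).

Lemma hyp_lorentz_ge1 p q : 1 <= lorentz (hyp_val p) (hyp_val q).
Proof. by apply: lorentz_ge1; exact: hyp_valP. Qed.

Lemma hyp_distxx p : hyp_dist p p = 0.
Proof. by rewrite /hyp_dist hyperboloid1 ?arcosh1// hyp_valP. Qed.

Lemma hyp_dist_positivity p q : hyp_dist p q = 0 -> p = q.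
Proof.
move=> pq; apply/val_inj/lorentz_eq1; [exact: valP|exact: valP|].
apply/eqP; rewrite eq_le hyp_lorentz_ge1 andbT.
by rewrite -ler_arcosh ?hyp_lorentz_ge1// arcosh1 -[leLHS]/(hyp_dist p q) pq.
Qed.

Lemma hyp_dist_sym p q : hyp_dist p q = hyp_dist q p.
Proof. by rewrite /hyp_dist lorentzC. Qed.

(** For three points of the hyperboloid [lorentz_gram] bounds [c - a * b] by the product of square
    roots in the addition formula [arcoshD]. *)
Lemma hyp_dist_triangle q p r : hyp_dist p r <= hyp_dist p q + hyp_dist q r.
Proof.
rewrite /hyp_dist arcoshD ?hyp_lorentz_ge1//.
have pq1 := hyp_lorentz_ge1 p q; have qr1 := hyp_lorentz_ge1 q r.
have := lorentz_gram (hyp_val r) (hyperboloid1 (hyp_valP p))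
  (hyperboloid1 (hyp_valP q)).
rewrite (hyperboloid1 (hyp_valP r)); have := hyp_lorentz_ge1 p r.
move: pq1 qr1; move: (lorentz (hyp_val p) (hyp_val q))
  (lorentz (hyp_val q) (hyp_val r)) (lorentz (hyp_val p) (hyp_val r)) => a b c a1 b1 c1 abc.
have sq0 (x : R) : 1 <= x -> 0 <= x ^+ 2 - 1.
  by move=> x1; rewrite subr_ge0 expr2 -{1}(mulr1 1) ler_pM.
have le : c <= a * b + Num.sqrt (a ^+ 2 - 1) * Num.sqrt (b ^+ 2 - 1).
  rewrite -lerBlDl -sqrtrM ?sq0//; apply: le_trans (ler_norm _) _.
  by rewrite -sqrtr_sqr; apply: ler_wsqrtr.
by rewrite ler_arcosh// (le_trans c1).
Qed.

HB.instance Definition _ := isMetric.Build R hyp_plane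
  hyp_distxx hyp_dist_positivity hyp_dist_sym hyp_dist_triangle.

Lemma hyp_mdistE (p q : hyp_plane) :
  mdist p q = arcosh (lorentz (hyp_val p) (hyp_val q)).
Proof. by []. Qed.

Lemma hyp_cts (T : topologicalType) (f : T -> hyp_plane) :
  continuous (fun t => (hyp_val (f t)).1.1) ->
  continuous (fun t => (hyp_val (f t)).1.2) ->
  continuous (fun t => (hyp_val (f t)).2) -> continuous f.
Proof.
move=> c1 c2 c3; apply/continuous_mdistP => t r r0.
have cl : continuous (fun s => lorentz (hyp_val (f t)) (hyp_val (f s))).
  move=> s; apply: cvgB; [apply: cvgB|]; apply: cvgM; try exact: cvg_cst.
  - exact: c1.
  - exact: c2.
  - exact: c3.
near=> s; rewrite hyp_mdistE arcosh_lt ?hyp_lorentz_ge1 ?(ltW r0)//.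
near: s; apply: (cvgr_lt _ (cl t)); rewrite (hyperboloid1 (hyp_valP _)).
by rewrite -arcosh_lt ?lexx ?arcosh1// ltW.
Unshelve. all: by end_near. Qed.

(** The topology is that of [hyp_dist], so coordinates must be controlled by the distance. With [c]
    the product of the two points, the change [a - b] is [(a - c * b) + (c - 1) * b], and
    [lorentz_gram] bounds the first term. *)
Lemma lorentz_cts (u : vec) :
  continuous (fun p : hyp_plane => lorentz (hyp_val p) u).
Proof.
move=> q; have FF : Filter (nbhs q) := nbhs_filter q.
apply/cvgrPdist_lt => r r0.
pose b := lorentz (hyp_val q) u; pose M := `|b ^+ 2 - lorentz u u| + 1.
have M0 : 0 < M by rewrite ltr_wpDl.
have N0 : 0 < `|b| + 1 by rewrite ltr_wpDl.
(* The second bound makes [3 * k * M <= (r / 2) ^+ 2], for the first term; the third makes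
   [k * |b| < r / 2], for the second. *)
pose k := Num.min 1 (Num.min (r ^+ 2 / (12 * M)) (r / (2 * (`|b| + 1)))).
have k0 : 0 < k.
  by rewrite !lt_min ltr01 !divr_gt0 ?exprn_gt0 ?mulr_gt0.
have k1 : k <= 1 by rewrite ge_min lexx.
have kM : 3 * k * M <= (r / 2) ^+ 2.
  have : k <= r ^+ 2 / (12 * M) by rewrite !ge_min lexx orbT.
  by rewrite ler_pdivlMr ?mulr_gt0// expr_div_n; lra.
have kb : k * `|b| < r / 2.
  have : k <= r / (2 * (`|b| + 1)) by rewrite !ge_min lexx !orbT.
  rewrite ler_pdivlMr ?mulr_gt0// => h; have : k * `|b| < k * (`|b| + 1).
    by rewrite ltr_pM2l// ltrDl.
  lra.
have d0 : 0 < arcosh (1 + k).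
  by rewrite -(@arcosh1 R) ltr_arcosh ?ltrDl// lerDl ltW.
near=> p.
have : mdist q p < arcosh (1 + k).
  near: p; apply: (iffLR (continuous_mdistP (@id hyp_plane)) _ q) => // t.
  exact: cvg_id.
rewrite hyp_mdistE ltr_arcosh ?hyp_lorentz_ge1//; last by rewrite lerDl ltW.
have := lorentz_gram u (hyperboloid1 (hyp_valP p)) (hyperboloid1 (hyp_valP q)).
rewrite (lorentzC (hyp_val q) (hyp_val p)) -/b.
have := hyp_lorentz_ge1 p q; move: (lorentz (hyp_val p) (hyp_val q)) => c c1.
move: (lorentz (hyp_val p) u) => a gram cl.
have h1 : `|a - c * b| <= r / 2.
  rewrite -ler_sqr ?nnegrE ?normr_ge0 ?divr_ge0 ?(ltW r0)// real_normK ?num_real//.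
  apply: le_trans gram _; apply: le_trans kM.
  apply: le_trans (_ : (c ^+ 2 - 1) * M <= _).
    rewrite ler_wpM2l//; first by rewrite subr_ge0 expr2 -{1}(mulr1 1) ler_pM.
    by apply: le_trans (ler_norm _) _; rewrite lerDl.
  rewrite ler_pM2r// -{1}(expr1n R 2) subr_sqr.
  by apply: le_trans (_ : k * 3 <= _); [apply: ler_pM; lra|lra].
have h2 : `|(c - 1) * b| < r / 2.
  rewrite normrM ger0_norm; last lra.
  by apply: le_lt_trans kb; rewrite ler_wpM2r//; lra.
have -> : b - a = - ((a - c * b) + (c - 1) * b) by ring.
rewrite normrN; apply: le_lt_trans (ler_normD _ _) _; lra.
Unshelve. all: by end_near. Qed.

End HyperbolicPlane.

(** * A global chart of the hyperbolic plane *)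

Section HyperbolicChart.
Context (R : realType).
Local Notation H2 := (hyp_plane R).
Local Notation I := (unit_interval R).
Implicit Types p q : H2.

(* The inverse of the ordinate in the upper half-plane. *)
Definition horo p : R := (hyp_val p).1.1 - (hyp_val p).1.2.

Lemma horo_mul p :
  horo p * ((hyp_val p).1.1 + (hyp_val p).1.2) = 1 + (hyp_val p).2 ^+ 2.
Proof.
have := hyperboloid1 (hyp_valP p); rewrite /lorentz /horo !expr2 => h.
rewrite mulrBl !mulrDr; move: h.
by rewrite (mulrC (hyp_val p).1.2 (hyp_val p).1.1); lra.
Qed.

Lemma horo_gt0 p : 0 < horo p.
Proof.
have t1 := hyperboloid_ge1 (hyp_valP p); have := horo_mul p.
have : 0 < 1 + (hyp_val p).2 ^+ 2 by rewrite ltr_pwDl// sqr_ge0.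
move=> /[swap] <-; rewrite /horo; nra.
Qed.

Definition hyp_chart p : R * R := ((hyp_val p).2 / horo p, - ln (horo p)).

(* The chart is the upper half-plane model with ordinate [expR z.2], so that it is
   defined on the whole of [R * R]. *)
Definition hyp_unchart_vec (z : R * R) : R * R * R :=
  let a := expR (- z.2) in let c := z.1 ^+ 2 * a + expR z.2 in
  ((a + c) / 2, (c - a) / 2, z.1 * a).

Lemma hyp_unchart_subproof z : hyperboloid (hyp_unchart_vec z).
Proof.
have e0 := expR_gt0 z.2; rewrite /hyperboloid /lorentz /hyp_unchart_vec /= expRN.
apply/andP; split; first by apply/eqP; field; rewrite gt_eqF.
have i0 : 0 < (expR z.2)^-1 by rewrite invr_gt0.
by rewrite divr_gt0// addr_gt0// ltr_wpDl// mulr_ge0 ?sqr_ge0// ltW.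
Qed.

Definition hyp_unchart z : H2 := Sub (hyp_unchart_vec z) (hyp_unchart_subproof z).

Lemma hyp_chartK : cancel hyp_chart hyp_unchart.
Proof.
move=> p; apply: val_inj; rewrite /= /hyp_unchart_vec /=.
have a0 := horo_gt0 p; have ac := horo_mul p.
rewrite opprK expRN lnK ?posrE// divfK ?gt_eqF//.
have -> : ((hyp_val p).2 / horo p) ^+ 2 * horo p + (horo p)^-1 =
    (hyp_val p).1.1 + (hyp_val p).1.2.
  apply: (mulfI (lt0r_neq0 a0)); rewrite ac; field; exact: lt0r_neq0.
rewrite /horo -[val p]/(hyp_val p); case: (hyp_val p) => [[t x] y] /=.
by congr (_, _, _); lra.
Qed.

Lemma horo_cts : continuous horo.
Proof.
have -> : horo = (fun p => lorentz (hyp_val p) (1, 1, 0)).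
  by apply/funext => p; rewrite /horo /lorentz /=; ring.
exact: lorentz_cts.
Qed.

Lemma hyp_chart_cts : continuous hyp_chart.
Proof.
have c0 : continuous (fun p => (hyp_val p).2).
  have -> : (fun p => (hyp_val p).2) = (fun p => lorentz (hyp_val p) (0, 0, -1)).
    by apply/funext => q; rewrite /lorentz /=; ring.
  exact: lorentz_cts.
have c1 : continuous (fun p => (hyp_val p).2 / horo p).
  move=> p; have FF : Filter (nbhs p) := nbhs_filter p.
  apply: cvgM; last first.
    by apply: cvgV; [exact/lt0r_neq0/horo_gt0|exact: horo_cts].
  exact: c0.
have c2 : continuous (fun p => - ln (horo p)).
  move=> p; have FF : Filter (nbhs p) := nbhs_filter p.
  apply: cvgN; apply: (@continuous_comp _ _ _ horo (@ln R)).
    exact: horo_cts.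
  exact/continuous_ln/horo_gt0.
move=> p; have FF : Filter (nbhs p) := nbhs_filter p.
exact: (cvg_pair (c1 p) (c2 p)).
Qed.

Lemma hyp_unchart_cts : continuous hyp_unchart.
Proof.
have ca : continuous (fun z : R * R => expR (- z.2)).
  move=> z; apply: (@continuous_comp _ _ _ (fun z : R * R => - z.2) (@expR R)).
    by apply: cvgN; exact: cvg_snd.
  exact: continuous_expR.
have ce : continuous (fun z : R * R => expR z.2).
  move=> z; apply: (@continuous_comp _ _ _ snd (@expR R)); first exact: cvg_snd.
  exact: continuous_expR.
have cc : continuous (fun z : R * R => z.1 ^+ 2 * expR (- z.2) + expR z.2).
  move=> z; apply: cvgD; last exact: ce.
  apply: cvgM; last exact: ca.
  by apply: cvgM; exact: cvg_fst.
apply: hyp_cts => z; rewrite /hyp_val /=.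
- by apply: cvgM; [apply: cvgD; [exact: ca|exact: cc]|exact: cvg_cst].
- by apply: cvgM; [apply: cvgB; [exact: cc|exact: ca]|exact: cvg_cst].
- by apply: cvgM; [exact: cvg_fst|exact: ca].
Qed.

Definition segment_fun (w z : R * R) (t : R) : R * R :=
  ((1 - t) * w.1 + t * z.1, (1 - t) * w.2 + t * z.2).

Lemma segment_fun_cts (T : topologicalType) (w z : T -> R * R) (t : T -> R) :
  continuous w -> continuous z -> continuous t ->
  continuous (fun s => segment_fun (w s) (z s) (t s)).
Proof.
move=> cw cz ct.
have comb (f g : T -> R) : continuous f -> continuous g ->
    continuous (fun s => (1 - t s) * f s + t s * g s).
  move=> cf cg s; apply: cvgD; apply: cvgM; [|exact: cf|exact: ct|exact: cg].
  by apply: cvgB; [exact: cvg_cst|exact: ct].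
have c1 (v : T -> R * R) : continuous v -> continuous (fun s => (v s).1).
  by move=> cv s; apply: continuous_comp; [exact: cv|exact: cvg_fst].
have c2 (v : T -> R * R) : continuous v -> continuous (fun s => (v s).2).
  by move=> cv s; apply: continuous_comp; [exact: cv|exact: cvg_snd].
move=> s.
exact: (cvg_pair (comb _ _ (c1 _ cw) (c1 _ cz) s) (comb _ _ (c2 _ cw) (c2 _ cz) s)).
Qed.

Lemma segment_fun0 w z : segment_fun w z 0 = w.
Proof. by rewrite /segment_fun subr0 !mul1r !mul0r !addr0; case: w. Qed.

Lemma segment_fun1 w z : segment_fun w z 1 = z.
Proof. by rewrite /segment_fun subrr !mul1r !mul0r !add0r; case: z. Qed.

Lemma segment_funxx w t : segment_fun w w t = w.
Proof. by rewrite /segment_fun -!mulrDl subrK !mul1r; case: w. Qed.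

Lemma comp_unchart_cts (T : topologicalType) (f : T -> R * R) :
  continuous f -> continuous (fun t => hyp_unchart (f t)).
Proof.
by move=> cf t; apply: continuous_comp; [exact: cf|exact: hyp_unchart_cts].
Qed.

Lemma comp_chart_cts (T : topologicalType) (f : T -> H2) :
  continuous f -> continuous (fun t => hyp_chart (f t)).
Proof.
by move=> cf t; apply: continuous_comp; [exact: cf|exact: hyp_chart_cts].
Qed.

Definition hyp_path_fun p q (t : I) : H2 :=
  hyp_unchart (segment_fun (hyp_chart p) (hyp_chart q) (valI t)).

Lemma hyp_path_cts p q : continuous (hyp_path_fun p q).
Proof.
apply: comp_unchart_cts; apply: segment_fun_cts.
- exact: cst_continuous.
- exact: cst_continuous.
- exact: valI_cts.
Qed.

Lemma hyp_path_zero p q : hyp_path_fun p q zero = p.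
Proof. by rewrite /hyp_path_fun valI0 segment_fun0 hyp_chartK. Qed.

Lemma hyp_path_one p q : hyp_path_fun p q one = q.
Proof. by rewrite /hyp_path_fun valI1 segment_fun1 hyp_chartK. Qed.

Definition hyp_path p q : {path I from p to q in H2} :=
  mk_path (@hyp_path_cts p q) (hyp_path_zero p q) (hyp_path_one p q).

(** The straight-line homotopy in the global chart. *)
Lemma hyp_simply p q (f g : {path I from p to q in H2}) : path_homotopic f g.
Proof.
exists (fun ts => hyp_unchart
  (segment_fun (hyp_chart (f ts.1)) (hyp_chart (g ts.1)) (valI ts.2))).
have cf (h : {path I from p to q in H2}) :
    continuous (fun ts : I * I => hyp_chart (h ts.1)).
  apply: comp_chart_cts => ts.
  apply: (@continuous_comp _ _ _ fst h); first exact: cvg_fst.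
  exact: cts_fun.
split.
- apply: comp_unchart_cts; apply: segment_fun_cts; [exact: cf|exact: cf|].
  move=> ts; apply: (@continuous_comp _ _ _ snd (@valI R)); first exact: cvg_snd.
  exact: valI_cts.
- by move=> t; rewrite /= valI0 segment_fun0 hyp_chartK.
- by move=> t; rewrite /= valI1 segment_fun1 hyp_chartK.
- by move=> s; rewrite /= !path_zero segment_funxx hyp_chartK.
- by move=> s; rewrite /= !path_one segment_funxx hyp_chartK.
Qed.

Definition half_plane p : R * R := ((hyp_val p).2 / horo p, (horo p)^-1).

Lemma half_plane_upper p : upper_half_plane (half_plane p).
Proof. by rewrite /upper_half_plane /= invr_gt0 horo_gt0. Qed.

Lemma half_plane_dist p q :
  hyperbolic_dist (half_plane p) (half_plane q) = mdist p q.
Proof.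
rewrite hyp_mdistE /hyperbolic_dist /half_plane /=; congr arcosh.
have a0 := lt0r_neq0 (horo_gt0 p); have b0 := lt0r_neq0 (horo_gt0 q).
have ac := horo_mul p; have bd := horo_mul q.
have pE : (hyp_val p).1.1 + (hyp_val p).1.2 = (1 + (hyp_val p).2 ^+ 2) / horo p.
  by rewrite -ac mulrC mulKf.
have qE : (hyp_val q).1.1 + (hyp_val q).1.2 = (1 + (hyp_val q).2 ^+ 2) / horo q.
  by rewrite -bd mulrC mulKf.
have -> : lorentz (hyp_val p) (hyp_val q) =
   (horo p * ((hyp_val q).1.1 + (hyp_val q).1.2) +
    horo q * ((hyp_val p).1.1 + (hyp_val p).1.2)) / 2
   - (hyp_val p).2 * (hyp_val q).2.
  by rewrite /lorentz /horo; field.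
rewrite pE qE; field; exact/andP.
Qed.

Lemma half_plane_surj w : upper_half_plane w -> exists p, half_plane p = w.
Proof.
move=> w0; exists (hyp_unchart (w.1, ln w.2)).
have e : horo (hyp_unchart (w.1, ln w.2)) = w.2^-1.
  rewrite /horo /hyp_val /= expRN lnK ?posrE//; field; exact: lt0r_neq0.
rewrite /half_plane e invrK /hyp_val /= expRN lnK ?posrE//.
by rewrite mulfVK ?lt0r_neq0//; case: w w0 {e}.
Qed.

Lemma hyp_bounded_compact (T : R) : exists2 K : set (R * R), compact K &
  forall p, (hyp_val p).1.1 <= T -> K (hyp_chart p).
Proof.
(* The value of [horo] lies between [1 / (2 * T)] and [2 * T], because [t - x] and [t + x] are at
   most [2 * T] and have product at least 1; moreover [|y| <= T]. *)
pose M := 2 * T * T; pose N := ln (2 * T).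
exists (`[- M, M] `*` `[- N, N]).
  by apply: compact_setX; exact: segment_compact.
move=> p pT; have t1 := hyperboloid_ge1 (hyp_valP p).
have a0 := horo_gt0 p; have ac := horo_mul p; have pp := hyperboloid1 (hyp_valP p).
move: pp ac pT t1 a0; rewrite /hyp_chart /lorentz /horo.
move: (hyp_val p) => [[t x] y] /= pp ac pT t1 a0.
have T1 : 1 <= T by lra.
have xt : `|x| <= t.
  rewrite -ler_sqr ?nnegrE//; last lra.
  by rewrite real_normK ?num_real// !expr2; have := sqr_ge0 y; rewrite expr2; lra.
have yt : `|y| <= t.
  rewrite -ler_sqr ?nnegrE//; last lra.
  by rewrite real_normK ?num_real// !expr2; have := sqr_ge0 x; rewrite expr2; lra.
move: xt; rewrite ler_norml => /andP[xt1 xt2].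
have aT : t - x <= 2 * T by lra.
have aV : (t - x)^-1 <= 2 * T.
  rewrite invf_ple ?posrE//; last lra.
  rewrite -(@ler_pM2r _ (2 * T)); last lra.
  rewrite mulVf; last by apply: lt0r_neq0; lra.
  have : (t - x) * (t + x) <= (t - x) * (2 * T) by rewrite ler_wpM2l//; lra.
  by rewrite ac; have := sqr_ge0 y; lra.
split; rewrite /= in_itv /=.
  rewrite -ler_norml normrM [`|_^-1|]gtr0_norm ?invr_gt0// /M mulrC.
  by apply: ler_pM => //; rewrite ?invr_ge0 ?(ltW a0)//; lra.
have n1 : - ln (t - x) <= N.
  by rewrite -lnV ?posrE// ler_ln ?posrE ?invr_gt0//; lra.
have n2 : ln (t - x) <= N by rewrite ler_ln ?posrE//; lra.
by apply/andP; split; lra.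
Qed.

End HyperbolicChart.

(** * The surface *)

Section EvenAction.
Context (R : realType) (V : finType) (e : V -> R * R * R).
Hypothesis e_norm : forall i, lorentz (e i) (e i) = -1.
Local Notation H2 := (hyp_plane R).
Local Notation G := (even_group e_norm).

Lemma even_act_subproof (a : G) (p : H2) :
  hyperboloid (word_act e (even_group_word a) (hyp_val p)).
Proof. exact: (word_act_hyperboloid e_norm _ (hyp_valP p)). Qed.

Definition even_act (a : G) (p : H2) : H2 :=
  Sub (word_act e (even_group_word a) (hyp_val p)) (even_act_subproof a p).

Lemma even_act1 p : even_act 1%g p = p.
Proof. by apply: val_inj; rewrite /= even_group_word1. Qed.

Lemma even_actM a b p : even_act (a * b)%g p = even_act a (even_act b p).
Proof. by apply: val_inj; rewrite /= even_group_wordM. Qed.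

Lemma even_act_isom a p q : mdist (even_act a p) (even_act a q) = mdist p q.
Proof. by rewrite !hyp_mdistE /hyp_val /= word_act_isom. Qed.

Context (k : R) (k1 : 1 < k).
Hypothesis e_gap : forall w q, (forall i, ~~ odd (count_mem i w)) ->
  hyperboloid q -> lorentz q (word_act e w q) < k -> word_act e w =1 id.

Lemma even_gap_gt0 : 0 < arcosh k.
Proof. by rewrite -(arcosh1 R) ltr_arcosh// ltW. Qed.

Lemma even_gapP (a : G) p : a != 1%g -> arcosh k <= mdist p (even_act a p).
Proof.
apply: contraR; rewrite -ltNge hyp_mdistE ltr_arcosh ?hyp_lorentz_ge1 ?ltW// => lt.
apply/eqP; apply: even_group_word_inj => q; rewrite even_group_word1.
exact: e_gap (even_group_word_even a) (hyp_valP p) lt _.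
Qed.

Definition even_action : isometric_action R :=
  IsometricAction even_act1 even_actM even_act_isom even_gap_gt0 even_gapP.

Lemma even_action_compact (l t : R) : 1 <= l ->
  (forall i p, hyperboloid p -> (lreflect (e i) p).1.1 <= l * p.1.1) ->
  (forall q, hyperboloid q -> exists w, hyperboloid (word_act e w q) /\
     (word_act e w q).1.1 <= t) ->
  compact [set: orbit_space even_action].
Proof.
move=> l1 refl_le cover.
have word_le w p : hyperboloid p -> (word_act e w p).1.1 <= l ^+ size w * p.1.1.
  move=> hp; elim: w => [|i w IH] /=; first by rewrite mul1r.
  have hq := word_act_hyperboloid e_norm w hp.
  apply: le_trans (refl_le i _ hq) _.
  by rewrite exprS -mulrA ler_wpM2l// (le_trans ler01).
have [K cK KP] := hyp_bounded_compact (l ^+ #|V| * t).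
apply: (@orbit_space_compact R even_action _ (@hyp_unchart R) K) => //.
  exact: hyp_unchart_cts.
move=> y; have [w [hw wt]] := cover _ (hyp_valP y).
(* The word [w] need not be even. Prepending its letters of odd count once each makes it even, at
   the cost of at most [#|V|] further reflections. *)
pose r := [seq i <- enum V | odd (count_mem i w)].
have ev : even_letters (r ++ w).
  apply/forallP => i; rewrite count_cat count_uniq_mem; last first.
    by rewrite filter_uniq// enum_uniq.
  by rewrite mem_filter mem_enum andbT oddD oddb addbb.
pose a : G := @pg_class (even_pregroup e_norm) (Sub (r ++ w) ev).
exists a, (hyp_chart (even_act a y)); split; last by rewrite hyp_chartK.
apply: KP; rewrite /hyp_val /=.
have -> : word_act e (even_group_word a) (hyp_val y) =
    word_act e (r ++ w) (hyp_val y).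
  exact: (@pg_repr_class (even_pregroup e_norm) (Sub (r ++ w) ev)).
rewrite word_act_cat; apply: le_trans (word_le _ _ hw) _.
apply: ler_pM => //; first by rewrite exprn_ge0// (le_trans ler01).
  by rewrite (le_trans ler01)// hyperboloid_ge1.
by rewrite ler_weXn2l// size_filter (leq_trans (count_size _ _))// -cardE.
Qed.

Lemma even_group_hyperbolic : compact [set: orbit_space even_action] ->
  hyperbolic_surface_group R G.
Proof.
move=> cX; pose y0 : ia_space even_action := hyp_unchart (0, 0).
exists (orbit_space even_action : metricType R), (orbit_of y0).
split; last first.
  exact: (@deck_group_iso R even_action (@hyp_path R) (@hyp_simply R) y0).
split=> //; first exact: (@orbit_space_connected R even_action (@hyp_path R) y0).
exact: (@orbit_space_locally_hyperbolic R even_action (@half_plane R)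
  (@half_plane_upper R) (@half_plane_dist R) (@half_plane_surj R)).
Qed.

End EvenAction.

(** * The graph product over the cycle *)

Unset Implicit Arguments.

Theorem corollary6 (R : realType) (m : nat) (hm : (5 <= m)%N)
    (G : 'I_m -> groupType) (hG : forall v : 'I_m, exists g : G v, g <> 1%g) :
  exists2 S : groupType,
    hyperbolic_surface_group R S &
    group_embeds S (graph_product (@cycle_graph m) G).
Proof.
pose e := @polygon_wall R m.
have e_norm := @polygon_norm R m hm : forall i, lorentz (e i) (e i) = -1.
have e_orth := @polygon_orth R m hm.
have gap0 := @polygon_gap_gt0 R m hm.
have apart := @polygon_apart R m hm.
have height0 := @polygon_height_gt0 R m hm.
have [b Hb] := @polygon_chamber_lorentz R m hm.
have [t Ht] := @polygon_chamber_height R m hm.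
have [l l1 Hl] := @polygon_lreflect_height R m hm.
have sym := @cycle_graph_sym m.
have [k k1 gapP] := displacement e_norm e_orth gap0 apart (fun=> erefl) height0
  (fun p i => Hb p i) sym.
exists (even_group e_norm).
  apply: (@even_group_hyperbolic R _ e e_norm k k1 gapP).
  apply: (@even_action_compact R _ e e_norm k k1 gapP l t l1 Hl) => q hq.
  have [w Cw] := chamber_exists e_norm e_orth gap0 apart (fun=> erefl) height0 hq.
  by exists w; split; [case: Cw|exact: Ht].
pose g v : G v := sval (cid (hG v)).
have Hg v : g v != 1%g by apply/eqP; exact: svalP (cid (hG v)).
apply: (@even_group_embeds R _ (@cycle_graph m) e e_norm e_orth _ _ G g Hg) => [i|w wid].
  (* The cycle has no loops: [ordS] wraps around only at the last vertex, and [m] exceeds 1. *)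
  rewrite /cycle_graph orbb; apply/negbTE/eqP => /(congr1 val) /=.
  have := ltn_ord i; have [im|im] := ltnP i.+1 m.
    by rewrite modn_small//; lia.
  move=> h; have e1 : i.+1 = m by lia.
  by rewrite e1 modnn; lia.
apply: (word_act_faithful e_norm e_orth gap0 apart (fun=> erefl) height0 sym).
exact: wid.
Qed.
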